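(* Let $\pi:M(c)\to N$ be an anti-invariant submersion from a quaternionic space form $(M(c),g_M)$ onto a Riemannian manifold $(N,g_N)$, and let $\{U_1,\dots,U_r\}$, $\{X_1,\dots,X_\ell\}$ be local orthonormal frames of $\mathcal V$ and $\mathcal H$. Then $$\hat\tau+\tau^*\ge\frac c4\Big((\ell+r)(\ell+r-1)+\sum_{\alpha=1}^3\sum_{i=1}^\ell\big(6\|B_{J_\alpha}X_i\|^2+3\|C_{J_\alpha}X_i\|^2\big)\Big)-r^2\|H\|^2+2\delta(N)-2\|\mathcal T^{\mathcal V}\|^2+2\|\mathcal A^{\mathcal H}\|^2-3\|\mathcal A^{\mathcal V}\|^2$$ and $$\hat\tau+\tau^*\le\frac c4\Big((\ell+r)(\ell+r-1)+\sum_{\alpha=1}^3\sum_{i=1}^\ell\big(6\|B_{J_\alpha}X_i\|^2+3\|C_{J_\alpha}X_i\|^2\big)\Big)-r^2\|H\|^2+\|\mathcal T^{\mathcal H}\|^2+2\delta(N)+2\|\mathcal A^{\mathcal H}\|^2-3\|\mathcal A^{\mathcal V}\|^2 .$$ In each of the two inequalities, equality holds for all $p\in M$ if and only if, for all $p\in M$, the fiber of $\pi$ through $p$ is a totally geodesic submanifold of $M$.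
   Context: An almost quaternionic Hermitian manifold $(M,E,g_M)$ is a $4m$-dimensional Riemannian manifold with a rank 3 subbundle $E\subset \mathrm{End}(TM)$ having, near each point, a local basis $\{J_1,J_2,J_3\}$ of sections with $J_\alpha^2=-\mathrm{id}$, $J_\alpha J_{\alpha+1}=-J_{\alpha+1}J_\alpha=J_{\alpha+2}$ (indices mod 3) and $g_M(J_\alpha X,J_\alpha Y)=g_M(X,Y)$. It is quaternionic Kähler if there are local 1-forms $\omega_1,\omega_2,\omega_3$ with $\nabla_XJ_\alpha=\omega_{\alpha+2}(X)J_{\alpha+1}-\omega_{\alpha+1}(X)J_{\alpha+2}$, $\nabla$ the Levi-Civita connection. A quaternionic space form $M(c)$ ($c\in\mathbb R$) is a quaternionic Kähler manifold whose curvature tensor is $$R(X,Y)Z=\tfrac c4\Big\{g_M(Y,Z)X-g_M(X,Z)Y+\sum_{\alpha=1}^3\big(g_M(J_\alpha Y,Z)J_\alpha X-g_M(J_\alpha X,Z)J_\alpha Y+2g_M(J_\alpha Y,X)J_\alpha Z\big)\Big\}.$$ A Riemannian submersion $\pi:(M,g_M)\to(N,g_N)$ ($\dim M>\dim N$) is a smooth surjective map of maximal rank whose differential restricted to $(\ker\pi_* )^\perp$ is a linear isometry. Write $\mathcal V=\ker\pi_*$ (vertical), $\mathcal H=(\ker\pi_* )^\perp$ (horizontal), $r=\dim\mathcal V$, $\ell=\dim\mathcal H$, and use the same letters for the orthogonal projections. The submersion $\pi$ is anti-invariant if $J_\alpha(\ker\pi_* )\subset(\ker\pi_* )^\perp$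 for $\alpha=1,2,3$. For horizontal $X$ write $J_\alpha X=B_{J_\alpha}X+C_{J_\alpha}X$ with $B_{J_\alpha}X$ vertical and $C_{J_\alpha}X$ horizontal; $\|B_{J_\alpha}X_i\|^2=\sum_{k=1}^r g_M(B_{J_\alpha}X_i,U_k)^2$, $\|C_{J_\alpha}X_i\|^2=\sum_{j=1}^\ell g_M(C_{J_\alpha}X_i,X_j)^2$. O'Neill tensors: $\mathcal A_EF=\mathcal H\nabla_{\mathcal HE}\mathcal VF+\mathcal V\nabla_{\mathcal HE}\mathcal HF$, $\mathcal T_EF=\mathcal H\nabla_{\mathcal VE}\mathcal VF+\mathcal V\nabla_{\mathcal VE}\mathcal HF$; the fibers are totally geodesic iff $\mathcal T$ vanishes identically. Notation: $\|\mathcal T^{\mathcal V}\|^2=\sum_{i=1}^\ell\sum_{k=1}^r\|\mathcal T_{U_k}X_i\|^2$, $\|\mathcal T^{\mathcal H}\|^2=\sum_{j,k=1}^r\|\mathcal T_{U_j}U_k\|^2$, $\|\mathcal A^{\mathcal V}\|^2=\sum_{i,j=1}^\ell\|\mathcal A_{X_i}X_j\|^2$, $\|\mathcal A^{\mathcal H}\|^2=\sum_{i=1}^\ell\sum_{k=1}^r\|\mathcal A_{X_i}U_k\|^2$. Put $N=\sum_{j=1}^r\mathcal T_{U_j}U_j$ (a horizontal vector field, not to be confused with the target manifold), $H=\frac1rN$ (mean curvature of the fibers), and $\delta(N)=\sum_{i=1}^\ell g_M(\nabla_{X_i}N,X_i)=\sum_{i=1}^\ell\sum_{k=1}^r g_M((\nabla_{X_i}\mathcal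 T)(U_k,U_k),X_i)$. Curvature convention: $R(X,Y,Z,W)=g_M(R(X,Y)Z,W)$; $\hat R$ is the curvature tensor of the vertical distribution (fibers) and $R^*$ that of the horizontal distribution (horizontal lift of the curvature tensor $R'$ of the target: $\pi_*(R^*(X,Y)Z)=R'(\pi_*X,\pi_*Y)\pi_*Z$). They satisfy, for vertical $U,V,F,W$ and horizontal $X,Y,Z,Z'$, $$R(U,V,F,W)=\hat R(U,V,F,W)+g_M(\mathcal T_UW,\mathcal T_VF)-g_M(\mathcal T_VW,\mathcal T_UF),$$ $$R(X,Y,Z,Z')=R^*(X,Y,Z,Z')-2g_M(\mathcal A_XY,\mathcal A_ZZ')+g_M(\mathcal A_YZ,\mathcal A_XZ')-g_M(\mathcal A_XZ,\mathcal A_YZ'),$$ $$R(X,V,Y,W)=g_M((\nabla_X\mathcal T)(V,W),Y)+g_M((\nabla_V\mathcal A)(X,Y),W)-g_M(\mathcal T_VX,\mathcal T_WY)+g_M(\mathcal A_YW,\mathcal A_XV);$$ the sign of the curvature tensors is the one for which these hold, i.e. $R(X,Y)Z=\nabla_{[X,Y]}Z-\nabla_X\nabla_YZ+\nabla_Y\nabla_XZ$. Finally $\hat\tau=\sum_{i,j=1}^r\hat R(U_j,U_i,U_i,U_j)$ and $\tau^*=\sum_{i,j=1}^\ell R^*(X_i,X_j,X_j,X_i)$. *)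

(* Defs.v *)
(* Manifolds are given by smooth atlases with values in 'rV[R]_n.  A tangent
   vector at p is the directional derivative it defines on functions smooth near
   p.  Vector fields are total functions on the manifold, only constrained on the
   open set where they are used, so every local object is a total function and
   no restriction map is needed. *)
From HB Require Import structures.
From mathcomp Require Import all_boot all_order all_algebra.
From mathcomp Require Import all_classical all_reals all_analysis.

Set Implicit Arguments.
Unset Strict Implicit.
Unset Printing Implicit Defensive.

Import Order.TTheory GRing.Theory Num.Theory.
Import numFieldNormedType.Exports.

Local Open Scope classical_set_scope.
Local Open Scope ring_scope.

Section EuclideanSmoothness.
Context {R : realType} {n : nat}.

Fixpoint Ck (k : nat) (O : set 'rV[R]_n) (f : 'rV[R]_n -> R) : Prop :=
  if k is k'.+1 then
    (forall x, O x -> differentiable f x) /\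
    (forall i : 'I_n, Ck k' O (fun x => 'D_(delta_mx 0 i) f x))
  else forall x, O x -> f y @[y --> x] --> f x.

Definition Cinf (O : set 'rV[R]_n) (f : 'rV[R]_n -> R) : Prop :=
  forall k, Ck k O f.

End EuclideanSmoothness.

Record chart (R : realType) (n : nat) (M : topologicalType) := Chart {
  chart_dom : set M;
  chart_map : M -> 'rV[R]_n;
  chart_inv : 'rV[R]_n -> M;
  _ : open chart_dom;
  _ : open (chart_map @` chart_dom);
  _ : forall x, chart_dom x -> chart_inv (chart_map x) = x;
  _ : forall x, chart_dom x -> chart_map y @[y --> x] --> chart_map x;
  _ : forall x, chart_dom x ->
        chart_inv y @[y --> chart_map x] --> chart_inv (chart_map x)
}.

Record manifold (R : realType) (n : nat) := Manifold {
  carrier :> topologicalType;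
  atlas : set (chart R n carrier);
  _ : hausdorff_space carrier;
  _ : @second_countable carrier;
  _ : forall x : carrier, exists2 c, atlas c & chart_dom c x;
  _ : forall c d, atlas c -> atlas d -> forall i : 'I_n,
        Cinf (chart_map c @` (chart_dom c `&` chart_dom d))
             (fun x => chart_map d (chart_inv c x) 0 i)
}.

Section Manifolds.
Context {R : realType} {n : nat}.
Implicit Type M : manifold R n.

(* smoothness on an open set W; nothing is required of f outside W *)
Definition smooth_on M (W : set M) (f : M -> R) : Prop :=
  forall c, atlas c ->
    Cinf (chart_map c @` (W `&` chart_dom c)) (f \o chart_inv c).

Definition smooth_at M (p : M) (f : M -> R) : Prop :=
  exists W : set M, [/\ open W, W p & smooth_on W f].

Definition functional M : Type := (M -> R) -> R^o.
HB.instance Definition _ M := GRing.Lmodule.on (functional M).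

(* T_pM.  A tangent vector sends functions that are not smooth at p to 0, so
   that equality of tangent vectors is Leibniz equality. *)
Definition tangent M (p : M) : set (functional M) :=
  [set v | exists c, [/\ atlas c, chart_dom c p & exists a : 'rV[R]_n,
     forall f, v f = if `[< smooth_at p f >]
                     then 'D_a (f \o chart_inv c) (chart_map c p) else 0]].

Definition field M : Type := M -> functional M.
HB.instance Definition _ M := GRing.Lmodule.on (field M).

Definition app M (X : field M) (f : M -> R) : M -> R := fun q => X q f.

Definition scale_field M (f : M -> R) (X : field M) : field M :=
  fun q => f q *: X q.

Definition distribution M : Type := forall p : M, set (functional M).

(* X is a smooth section of D over the open set W; D is a distribution of
   subspaces of the tangent spaces *)
Definition section_on M (D : distribution M) (W : set M) (X : field M) : Prop :=
  (forall q, W q -> D q (X q)) /\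
  (forall (O : set M) f, open O -> O `<=` W -> smooth_on O f ->
     smooth_on O (app X f)).

Definition section_at M (D : distribution M) (p : M) (X : field M) : Prop :=
  exists W : set M, [/\ open W, W p & section_on D W X].

Definition lie M (X Y : field M) : field M := fun p f =>
  if `[< smooth_at p f >] then X p (app Y f) - Y p (app X f) else 0.

Record metric M := Metric {
  metric_fun :> M -> functional M -> functional M -> R;
  _ : forall p u v, tangent p u -> tangent p v ->
        metric_fun p u v = metric_fun p v u;
  _ : forall p (a : R) u v w, tangent p u -> tangent p v -> tangent p w ->
        metric_fun p (a *: u + v) w = a * metric_fun p u w + metric_fun p v w;
  _ : forall p v, tangent p v -> v != 0 -> 0 < metric_fun p v v;
  _ : forall (W : set M) X Y, open W ->
        section_on (@tangent M) W X -> section_on (@tangent M) W Y ->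
        smooth_on W (fun q => metric_fun q (X q) (Y q))
}.

(* [nabla p v Y] is the covariant derivative at p of the local field Y along v. *)
Definition connection M : Type := M -> functional M -> field M -> functional M.

Definition cov M (nabla : connection M) (X Y : field M) : field M :=
  fun q => nabla q (X q) Y.

(* Levi-Civita connection of an involutive distribution D (metric and
   torsion-free, for sections of D differentiated along D).  For D = TM it is the
   Levi-Civita connection of (M, g); for D the vertical distribution of a
   submersion it restricts on each fiber to the Levi-Civita connection of the
   induced metric. *)
Definition levi_civita M (g : metric M) (D : distribution M)
    (nabla : connection M) : Prop :=
  [/\ forall p v Y, D p v -> section_at D p Y -> D p (nabla p v Y),
      forall p (a : R) u v Y, D p u -> D p v -> section_at D p Y ->
        nabla p (a *: u + v) Y = a *: nabla p u Y + nabla p v Y,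
      forall p v Y Z, D p v -> section_at D p Y -> section_at D p Z ->
        nabla p v (Y + Z) = nabla p v Y + nabla p v Z,
      forall p v f Y, D p v -> smooth_at p f -> section_at D p Y ->
        nabla p v (scale_field f Y) = v f *: Y p + f p *: nabla p v Y &
      forall (W : set M) X Y, open W -> section_on D W X -> section_on D W Y ->
        section_on D W (cov nabla X Y)] /\
  (forall p v Y Z, D p v -> section_at D p Y -> section_at D p Z ->
     v (fun q => g q (Y q) (Z q)) = g p (nabla p v Y) (Z p) + g p (Y p) (nabla p v Z)) /\
  (forall p X Y, section_at D p X -> section_at D p Y ->
     cov nabla X Y p - cov nabla Y X p = lie X Y p).

Definition curvature_op M : Type :=
  M -> functional M -> functional M -> functional M -> functional M.

(* R(X,Y)Z = nabla_[X,Y] Z - nabla_X nabla_Y Z + nabla_Y nabla_X Z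
   (opposite of the most common sign convention) *)
Definition curv M (nabla : connection M) (X Y Z : field M) : field M :=
  cov nabla (lie X Y) Z - cov nabla X (cov nabla Y Z) + cov nabla Y (cov nabla X Z).

Definition curvature_tensor M (D : distribution M) (nabla : connection M) (Rt : curvature_op M) : Prop :=
  forall p X Y Z, section_at D p X -> section_at D p Y -> section_at D p Z ->
    Rt p (X p) (Y p) (Z p) = curv nabla X Y Z p.

Definition orthonormal_frame_on M (g : metric M) (D : distribution M) (k : nat)
    (W : set M) (F : 'I_k -> field M) : Prop :=
  [/\ forall i, section_on D W (F i),
      forall q i j, W q -> g q (F i q) (F j q) = (i == j)%:R &
      forall q v, W q -> D q v ->
        exists a : 'I_k -> R, v = \sum_(i < k) a i *: F i q].

Definition orthonormal_frame_at M (g : metric M) (D : distribution M) (k : nat)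
    (p : M) (F : 'I_k -> field M) : Prop :=
  exists W : set M, [/\ open W, W p & orthonormal_frame_on g D W F].

Definition sqnorm M (g : metric M) (p : M) (v : functional M) : R := g p v v.

End Manifolds.

Section Submersions.
Context {R : realType} {m n : nat} (M : manifold R m) (B : manifold R n).
Implicit Types (pi : M -> B) (g : metric M) (nabla : connection M).

Definition smooth_map pi : Prop :=
  continuous pi /\
  forall (O : set B) f, open O -> smooth_on O f -> smooth_on (pi @^-1` O) (f \o pi).

Definition dmap pi (p : M) (v : functional M) : functional B := fun f =>
  if `[< smooth_at (pi p) f >] then v (f \o pi) else 0.

Definition vertical pi : distribution M :=
  fun p => [set v | tangent p v /\ dmap pi p v = 0].

Definition horizontal g pi : distribution M :=
  fun p => [set v | tangent p v /\ forall u, vertical pi p u -> g p u v = 0].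

Definition riemannian_submersion g (gB : metric B) pi : Prop :=
  [/\ (n < m)%N, smooth_map pi, (forall b, exists p, pi p = b),
      forall p w, tangent (pi p) w -> exists2 v, tangent p v & dmap pi p v = w &
      forall p u v, horizontal g pi p u -> horizontal g pi p v ->
        gB (pi p) (dmap pi p u) (dmap pi p v) = g p u v].

Definition vproj g pi (p : M) (v : functional M) : functional M :=
  xget 0 [set u | vertical pi p u /\ horizontal g pi p (v - u)].

Definition hproj g pi (p : M) (v : functional M) : functional M :=
  v - vproj g pi p v.

Definition vpart g pi (E : field M) : field M := fun q => vproj g pi q (E q).
Definition hpart g pi (E : field M) : field M := fun q => hproj g pi q (E q).

Definition oneillT g pi nabla (E F : field M) : field M :=
  hpart g pi (cov nabla (vpart g pi E) (vpart g pi F)) +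
  vpart g pi (cov nabla (vpart g pi E) (hpart g pi F)).

Definition oneillA g pi nabla (E F : field M) : field M :=
  hpart g pi (cov nabla (hpart g pi E) (vpart g pi F)) +
  vpart g pi (cov nabla (hpart g pi E) (hpart g pi F)).

(* the second fundamental form of the fiber over b vanishes *)
Definition totally_geodesic_fiber pi nabla (b : B) : Prop :=
  forall q U V, pi q = b -> section_at (vertical pi) q U ->
    section_at (vertical pi) q V -> vertical pi q (cov nabla U V q).

(* Rs is the horizontal lift of the curvature tensor RB of the base. *)
Definition horizontal_curvature g pi
    (RB : curvature_op B) (Rs : curvature_op M) : Prop :=
  forall p x y z, horizontal g pi p x -> horizontal g pi p y -> horizontal g pi p z ->
    horizontal g pi p (Rs p x y z) /\
    dmap pi p (Rs p x y z) = RB (pi p) (dmap pi p x) (dmap pi p y) (dmap pi p z).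

Section Frames.
Variables (g : metric M) (pi : M -> B) (nabla : connection M) (r l : nat).
Variables (U : 'I_r -> field M) (X : 'I_l -> field M).

(* the field N = r H *)
Definition mean_field : field M := \sum_(k < r) oneillT g pi nabla (U k) (U k).

Definition mean_curvature : field M := (r%:R^-1 : R) *: mean_field.

Definition deltaN (p : M) : R :=
  \sum_(i < l) g p (cov nabla (X i) mean_field p) (X i p).

Definition normTV (p : M) : R :=
  \sum_(i < l) \sum_(k < r) sqnorm g p (oneillT g pi nabla (U k) (X i) p).

Definition normTH (p : M) : R :=
  \sum_(j < r) \sum_(k < r) sqnorm g p (oneillT g pi nabla (U j) (U k) p).

Definition normAV (p : M) : R :=
  \sum_(i < l) \sum_(j < l) sqnorm g p (oneillA g pi nabla (X i) (X j) p).

Definition normAH (p : M) : R :=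
  \sum_(i < l) \sum_(k < r) sqnorm g p (oneillA g pi nabla (X i) (U k) p).

Definition tau_hat (nablaV : connection M) (p : M) : R :=
  \sum_(i < r) \sum_(j < r) g p (curv nablaV (U j) (U i) (U i) p) (U j p).

Definition tau_star (Rs : curvature_op M) (p : M) : R :=
  \sum_(i < l) \sum_(j < l) g p (Rs p (X i p) (X j p) (X j p)) (X i p).

(* For an endomorphism field J: squared norms of the vertical part B_J X_i and
   of the horizontal part C_J X_i of J X_i. *)
Definition normBJ (J : M -> functional M -> functional M) (i : 'I_l) (p : M) : R :=
  \sum_(k < r) g p (vproj g pi p (J p (X i p))) (U k p) ^+ 2.

Definition normCJ (J : M -> functional M -> functional M) (i : 'I_l) (p : M) : R :=
  \sum_(j < l) g p (hproj g pi p (J p (X i p))) (X j p) ^+ 2.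

End Frames.
End Submersions.

Section Quaternionic.
Context {R : realType} {n : nat} {M : manifold R n}.

Definition endo_field : Type := M -> functional M -> functional M.

Definition act (J : endo_field) (X : field M) : field M := fun q => J q (X q).

Definition smooth_endo_on (W : set M) (J : endo_field) : Prop :=
  [/\ forall q v, W q -> tangent q v -> tangent q (J q v),
      forall q (a : R) u v, W q -> tangent q u -> tangent q v ->
        J q (a *: u + v) = a *: J q u + J q v &
      forall (O : set M) X, open O -> O `<=` W -> section_on (@tangent R n M) O X ->
        section_on (@tangent R n M) O (act J X)].

Definition smooth_form_on (W : set M) (w : M -> functional M -> R) : Prop :=
  (forall q (a : R) u v, W q -> tangent q u -> tangent q v ->
     w q (a *: u + v) = a * w q u + w q v) /\
  (forall (O : set M) X, open O -> O `<=` W -> section_on (@tangent R n M) O X ->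
     smooth_on O (fun q => w q (X q))).

(* {J_0, J_1, J_2} is an admissible local basis over W of the bundle whose fiber
   at q is E q; an element of E q is only determined by its values on T_qM.
   Indices live in 'Z_3. *)
Definition admissible_basis_on (g : metric M)
    (E : M -> set (functional M -> functional M))
    (W : set M) (J : 'Z_3 -> endo_field) : Prop :=
  [/\ forall a, smooth_endo_on W (J a),
      forall a q v, W q -> tangent q v -> J a q (J a q v) = - v,
      forall a q v, W q -> tangent q v ->
        J a q (J (a + 1) q v) = J (a + 2) q v /\
        J (a + 1) q (J a q v) = - J (a + 2) q v,
      forall a q u v, W q -> tangent q u -> tangent q v ->
        g q (J a q u) (J a q v) = g q u v &
      forall q phi, W q ->
        (E q phi <-> exists t : 'Z_3 -> R, forall v, tangent q v ->
           phi v = \sum_a t a *: J a q v)].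

Definition admissible_basis_at g E (p : M) (J : 'Z_3 -> endo_field) : Prop :=
  exists W : set M, [/\ open W, W p & admissible_basis_on g E W J].

Definition almost_quaternionic_hermitian g E : Prop :=
  forall p, exists J, admissible_basis_at g E p J.

Definition quaternionic_kahler g E (nabla : connection M) : Prop :=
  almost_quaternionic_hermitian g E /\
  forall (W : set M) J, open W -> admissible_basis_on g E W J ->
    exists2 w : 'Z_3 -> M -> functional M -> R,
      (forall a, smooth_form_on W (w a)) &
      forall a q v Y, W q -> tangent q v -> section_at (@tangent R n M) q Y ->
        nabla q v (act (J a) Y) - J a q (nabla q v Y) =
        w (a + 2) q v *: J (a + 1) q (Y q) - w (a + 1) q v *: J (a + 2) q (Y q).

Definition quaternionic_space_form g E (nabla : connection M) (c : R) : Prop :=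
  quaternionic_kahler g E nabla /\
  forall (W : set M) J, open W -> admissible_basis_on g E W J ->
    forall q X Y Z, W q -> section_at (@tangent R n M) q X ->
      section_at (@tangent R n M) q Y -> section_at (@tangent R n M) q Z ->
      curv nabla X Y Z q =
      (c / 4) *: (g q (Y q) (Z q) *: X q - g q (X q) (Z q) *: Y q +
        \sum_a (g q (J a q (Y q)) (Z q) *: J a q (X q)
                - g q (J a q (X q)) (Z q) *: J a q (Y q)
                + (2 * g q (J a q (Y q)) (X q)) *: J a q (Z q))).

Definition anti_invariant g E k (B : manifold R k) (pi : M -> B) : Prop :=
  forall (W : set M) J, open W -> admissible_basis_on g E W J ->
    forall a q v, W q -> vertical pi q v -> horizontal g pi q (J a q v).

End Quaternionic.

(* Main.v *)
(** Gauss' equation for the fibers and O'Neill's equation for the base express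
    hat tau and tau^* through the vertical and the horizontal sectional
    curvatures of M, which the space form equation evaluates.  It also evaluates
    the mixed sectional curvatures, whose sum over orthonormal frames is
    - delta(N) - |A^H|^2 + |T^V|^2.  Eliminating, hat tau + tau^* is the lower
    bound plus |T^H|^2 and the upper bound minus 2 |T^V|^2; since
    |T^V| = |T^H|, both bounds and both equality cases follow.

    O'Neill's equation and the skew-symmetry of A rest on basic fields: a
    tangent vector of the base extends to a coordinate field, whose horizontal
    lift is smooth, and Koszul's formula shows that d pi maps the covariant
    derivative of lifts to that of the base fields.  The symmetry of second
    derivatives is never used: torsion-freeness already makes Lie brackets
    tangent. *)

From mathcomp Require Import all_boot all_order all_algebra.
From mathcomp Require Import all_classical all_reals all_analysis.
From mathcomp Require Import ring lra.
Require Import Defs.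

Set Implicit Arguments.
Unset Strict Implicit.
Unset Printing Implicit Defensive.

Import Order.TTheory GRing.Theory Num.Theory.
Import numFieldNormedType.Exports.

Local Open Scope classical_set_scope.
Local Open Scope ring_scope.

(** A connection acts on germs of total fields and is linear over functions only in its direction,
    so tensoriality of T, A and R has to be earned. O'Neill's equation is proved for basic fields,
    while the frame [X] is arbitrary; the transfer works because A, and the curvature of a space
    form, depend only on values at the point. For the mixed curvatures no covariant derivative of T
    or A is formed: raw derivatives of the frame fields are kept, and the non-tensorial coefficients
    cancel once the sum over the frames is taken, a skew array meeting the symmetric T.

    With the sign of [curv], g(R(Y,Z)Z,Y) is the opposite of the sectional curvature in the common
    convention; hence O'Neill's equation shows +3|A|^2 and Gauss' equation +|T|^2.

    The constants of the bounds come from using the mixed identity twice: it supplies the cross term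
    2 l r of (l+r)(l+r-1), the factor 6 = 2 * 3 before |B|^2, and the terms 2 delta(N), 2|A^H|^2 and
    -2|T^V|^2. *)

Lemma open_nearS (T : topologicalType) (O : set T) (P : T -> Prop) (x : T) :
  open O -> O x -> (forall y, O y -> P y) -> \forall y \near x, P y.
Proof. by move=> oO Ox OP; apply: filterS (open_nbhs_nbhs (conj oO Ox)). Qed.

Lemma near_open (T : topologicalType) (P : T -> Prop) (x : T) :
  (\forall y \near x, P y) ->
  exists O : set T, [/\ open O, O x & forall y, O y -> P y].
Proof.
rewrite /prop_near1 nbhsE; move=> [ O [ oO Ox] OP].
by exists O; split=> // y /OP.
Qed.

(** * Smooth functions on open subsets of R^n *)

Section Euclid.
Context {R : realType} {n : nat}.
Implicit Types (O : set 'rV[R]_n) (f g : 'rV[R]_n -> R).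

Lemma derive_coord f (x a : 'rV[R]_n) : differentiable f x ->
  'D_a f x = \sum_(i < n) a 0 i * 'D_(delta_mx 0 i) f x.
Proof.
move=> df; rewrite {1}(row_sum_delta a) deriveE// linear_sum.
by apply: eq_bigr => i _; rewrite linearZ /= deriveE.
Qed.

(** Near [x] the function is a constant plus the zero linear map with remainder exactly 0. With
    [differentiable_near], this makes differentiability a property of germs, as needed for functions
    unconstrained off an open set. *)
Lemma differentiable_near0 f (x : 'rV[R]_n) :
  (\near x, f x = 0) -> differentiable f x.
Proof.
move=> fx.
have fy : \forall y \near (0 : 'rV[R]_n), f (y + x) = 0.
  by move: fx; rewrite (near_shift (0 : 'rV[R]_n)) subr0.
have f0 : f \o shift x = cst (f x) + (\0 : {linear 'rV[R]_n -> R^o}) +o_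
  (0 : 'rV[R]_n) id.
  apply/eqaddoP => e e0; near=> y.
  change (`|f (y + x) - (f x + 0)| <= e * `|y|).
  rewrite (nbhs_singleton fx) addr0 subr0.
  by rewrite (near fy y)// normr0 mulr_ge0// ltW.
apply/diff_locallyP; rewrite (diff_unique _ f0); last exact: cst_continuous.
split=> //; exact: cst_continuous.
Unshelve. all: by end_near. Qed.

Lemma differentiable_near f g (x : 'rV[R]_n) :
  (\near x, f x = g x) -> differentiable f x -> differentiable g x.
Proof.
move=> fg df; rewrite (_ : g = f + (g - f)); last by rewrite addrC subrK.
apply: differentiableD => //; apply: differentiable_near0.
by apply: filterS fg => y /= fgy; rewrite !fctE fgy subrr.
Qed.

Lemma Ck_sub k O O' f : O' `<=` O -> Ck k O f -> Ck k O' f.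
Proof.
move=> sO; elim: k f => [|k IH] f /=; first by move=> cf x /sO /cf.
by move=> [df Df]; split=> [x /sO /df //|i]; exact: IH.
Qed.

(** Chart expressions agree only on the open set in question; openness turns equality on [O] into
    equality of germs, which derivatives respect. *)
Lemma Ck_ext k O f g : open O -> (forall x, O x -> f x = g x) ->
  Ck k O f -> Ck k O g.
Proof.
move=> oO; elim: k f g => [|k IH] f g fg.
  move=> cf x Ox; rewrite -fg// => P /(cf x Ox) Pf.
  have Qf : nbhs x (fun y => P (f y)) by exact: Pf.
  by apply: filterS2 Qf (open_nearS oO Ox fg) => y /= Pfy <-.
move=> [df Df]; have nfg x (Ox : O x) := open_nearS oO Ox fg.
split=> [x Ox|i]; first exact: differentiable_near (nfg x Ox) (df x Ox).
by apply: IH (Df i) => x Ox; apply: near_eq_derive; exact: nfg.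
Qed.

Lemma CkW k O f : Ck k.+1 O f -> Ck k O f.
Proof.
elim: k f => [|k IH] f; first by case=> df _ x /df /differentiable_continuous.
by case=> df Df; split=> // i; apply: IH; exact: Df.
Qed.

Lemma Ck_cst k O (a : R) : Ck k O (fun=> a).
Proof.
elim: k a => [|k IH] a; first by move=> x _;
  exact/differentiable_continuous/differentiable_cst.
split=> [x _|i]; first exact: differentiable_cst.
suff -> : (fun x : 'rV[R]_n => 'D_(delta_mx 0 i) (fun=> a) x) = (fun=> 0) by [].
by apply/funext => x; exact: derive_cst.
Qed.

Lemma Ck_add k O f g : open O -> Ck k O f -> Ck k O g ->
  Ck k O (fun x => f x + g x).
Proof.
move=> oO; elim: k f g => [|k IH] f g.
  by move=> cf cg x Ox; exact: (cvgD (cf x Ox) (cg x Ox)).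
move=> [df Df] [dg Dg]; split=> [x Ox|i].
  by apply: differentiableD; [exact: df|exact: dg].
apply: Ck_ext (IH _ _ (Df i) (Dg i)) => // x Ox.
by rewrite -deriveD//; apply: diff_derivable; [exact: df|exact: dg].
Qed.

Lemma Ck_mul k O f g : open O -> Ck k O f -> Ck k O g ->
  Ck k O (fun x => f x * g x).
Proof.
move=> oO; elim: k f g => [|k IH] f g.
  by move=> cf cg x Ox; exact: (cvgM (cf x Ox) (cg x Ox)).
move=> Cf Cg; have [[df Df] [dg Dg]] := (Cf, Cg); split=> [x Ox|i].
  by apply: differentiableM; [exact: df|exact: dg].
apply: Ck_ext (Ck_add oO (IH _ _ (CkW Cf) (Dg i)) (IH _ _ (CkW Cg)
  (Df i))) => //.
by move=> x Ox; rewrite deriveM//; apply: diff_derivable; [exact: df|exact: dg].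
Qed.

Lemma Ck_sum k O (I : Type) (s : seq I) (F : I -> 'rV[R]_n -> R) : open O ->
  (forall i, Ck k O (F i)) -> Ck k O (fun x => \sum_(i <- s) F i x).
Proof.
move=> oO CF; elim: s => [|i s IH].
  by apply: Ck_ext (Ck_cst k O 0) => // x _; rewrite big_nil.
by apply: Ck_ext (Ck_add oO (CF i) IH) => // x _; rewrite big_cons.
Qed.

End Euclid.

(** * The chain rule and composition of smooth maps *)

Section ChainRule.
Context {R : realType} {n m : nat}.
Implicit Types (O : set 'rV[R]_n) (phi : 'rV[R]_n -> 'rV[R]_m)
  (f : 'rV[R]_m -> R).

Lemma differentiable_rV phi (x : 'rV[R]_n) :
  (forall j, differentiable (fun y => phi y 0 j) x) -> differentiable phi x.
Proof.
move=> dphi.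
rewrite (_ : phi = \sum_(j < m) (fun y => phi y 0 j *: delta_mx 0 j)).
  by apply: differentiable_sum => j; exact: differentiableZl.
by apply/funext => y; rewrite fct_sumE {1}(row_sum_delta (phi y)).
Qed.

Lemma chain_rule phi f (x a : 'rV[R]_n) :
  (forall j, differentiable (fun y => phi y 0 j) x) ->
  differentiable f (phi x) ->
  differentiable (f \o phi) x /\
  'D_a (f \o phi) x = 'D_(\row_j 'D_a (fun y => phi y 0 j) x) f (phi x).
Proof.
move=> dphi df; have dp := differentiable_rV dphi.
have dc : differentiable (f \o phi) x by exact: differentiable_comp.
split=> //; rewrite !deriveE// diff_comp//=; congr ('d f _ _).
rewrite -deriveE// derive_mx; last exact: diff_derivable.
by apply/matrixP => i j; rewrite !mxE (ord1 i).
Qed.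

(** Induction on the order of [f]: each partial derivative of the composite is a sum of products of
    partials of [phi] with partials of [f] composed with [phi]. The extra derivative of [phi] pays
    for the case of order 0, where its continuity comes from differentiability of its components. *)
Lemma Ck_comp k O (O' : set 'rV[R]_m) phi f : open O ->
  (forall x, O x -> O' (phi x)) -> (forall j, Ck k.+1 O (fun x => phi x 0 j)) ->
  Ck k O' f -> Ck k O (f \o phi).
Proof.
move=> oO OO'; elim: k f => [|k IH] f Cphi Cf.
  move=> x Ox; have dphi : differentiable phi x.
    by apply: differentiable_rV => j; have [d _] := Cphi j; exact: d.
  have cp := differentiable_continuous dphi.
  have cf : {for phi x, continuous f} := Cf _ (OO' _ Ox).
  exact: (continuous_comp cp cf).
have [df Df] := Cf; have dphi x j : O x -> differentiable
  (fun y => phi y 0 j) x.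
  by move=> Ox; have [d _] := Cphi j; exact: d.
split=> [x Ox|i].
  by have [] := @chain_rule phi f x 0 (fun j => dphi x j Ox) (df _ (OO' _ Ox)).
apply: (@Ck_ext _ _ _ _ (fun x => \sum_(j < m)
    'D_(delta_mx 0 i) (fun y => phi y 0 j) x * 'D_(delta_mx 0 j) f
      (phi x))) => //.
  move=> x Ox.
  have [_ ->] := @chain_rule phi f x (delta_mx 0 i) (fun j => dphi x j Ox)
    (df _ (OO' _ Ox)).
  rewrite derive_coord; last exact: df (OO' _ Ox).
  by apply: eq_bigr => j _; rewrite mxE.
apply: Ck_sum => // j; apply: Ck_mul => //; first by have [_ C] := Cphi j;
  exact/CkW/C.
apply: (IH (fun y => 'D_(delta_mx 0 j) f y)); last exact: Df.
by move=> j'; exact/CkW/Cphi.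
Qed.

Lemma Cinf_comp O (O' : set 'rV[R]_m) phi f : open O ->
  (forall x, O x -> O' (phi x)) -> (forall j, Cinf O (fun x => phi x 0 j)) ->
  Cinf O' f -> Cinf O (f \o phi).
Proof. by move=> oO OO' Cphi Cf k; apply: Ck_comp OO' _ (Cf k) => // j;
  exact: Cphi. Qed.

End ChainRule.

Lemma Cinf_differentiable (R : realType) n (O : set 'rV[R]_n) f x :
  Cinf O f -> O x -> differentiable f x.
Proof. by move=> /(_ 1%N)[df _]; exact: df. Qed.

Lemma Cinf_derive (R : realType) n (O : set 'rV[R]_n) f (a : 'rV[R]_n) :
  open O -> Cinf O f -> Cinf O (fun x => 'D_a f x).
Proof.
move=> oO Cf k.
apply: (@Ck_ext _ _ _ _ (fun x => \sum_(i < n) a 0 i * 'D_(delta_mx 0 i) f x))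
  => //.
  by move=> x Ox; rewrite derive_coord//; exact: Cinf_differentiable Ox.
by apply: Ck_sum => // i; apply: Ck_mul => //;
  [exact: Ck_cst|have [_ D] := Cf k.+1; exact: D].
Qed.

(** * Smooth functions and tangent vectors on manifolds *)

Section Charts.
Context {R : realType} {n : nat} {M : manifold R n}.
Implicit Types (c d : chart R n M) (W O : set M) (f g : M -> R) (p q : M).

Lemma chart_dom_open c : open (chart_dom c). Proof. by case: c. Qed.

Lemma chart_mapK c x : chart_dom c x -> chart_inv c (chart_map c x) = x.
Proof. by case: c x => ? ? ? ? ? K ? ? x /K. Qed.

(** Near an image point, the image is cut out by two open conditions: lying in the range of the
    chart, and being sent into [W] by the continuous inverse. *)
Lemma chart_image_open c W : open W -> open (chart_map c @`
  (W `&` chart_dom c)).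
Proof.
move=> oW; rewrite openE => _ [x [Wx cx] <-].
have oimg : open (chart_map c @` chart_dom c) by case: c {cx}.
have cinv : chart_inv c y @[y --> chart_map c x] --> chart_inv c
  (chart_map c x).
  by move: cx {oimg}; case: c => ? ? ? ? ? ? ? H /H.
have nW : nbhs (chart_map c x) (fun z => W (chart_inv c z)).
  apply: cinv; apply: open_nbhs_nbhs; split=> //.
  by rewrite chart_mapK.
have nimg : nbhs (chart_map c x) (chart_map c @` chart_dom c).
  by apply: open_nbhs_nbhs; split=> //; exists x.
apply: filterS2 nW nimg => z + [w cw wz]; rewrite -wz chart_mapK// => Ww.
by exists w.
Qed.

Lemma chart_at p : exists2 c : chart R n M, atlas c & chart_dom c p.
Proof. by case: M p => ? ? ? ? H ? p; exact: H. Qed.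

Lemma transition_smooth c d (i : 'I_n) : atlas c -> atlas d ->
  Cinf (chart_map c @` (chart_dom c `&` chart_dom d))
       (fun x => chart_map d (chart_inv c x) 0 i).
Proof. by case: M c d => ? ? ? ? ? H c d ac ad; exact (H _ _ ac ad i). Qed.

Lemma smooth_on_sub W O f : O `<=` W -> smooth_on W f -> smooth_on O f.
Proof.
move=> OW sf c ac k; apply: Ck_sub (sf c ac k).
by apply: image_subset => x [/OW].
Qed.

Lemma smooth_on_ext W f g : open W -> (forall q, W q -> f q = g q) ->
  smooth_on W f -> smooth_on W g.
Proof.
move=> oW fg sf c ac k; apply: Ck_ext (sf c ac k);
  first exact: chart_image_open.
by move=> _ [x [Wx cx] <-] /=; rewrite chart_mapK// fg.
Qed.

Lemma smooth_on_cst W (a : R) : smooth_on W (fun=> a).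
Proof. by move=> c ac k; exact: Ck_cst. Qed.

Lemma smooth_on_add W f g : open W -> smooth_on W f -> smooth_on W g ->
  smooth_on W (fun q => f q + g q).
Proof.
by move=> oW sf sg c ac k; apply: Ck_add (sf c ac k) (sg c ac k);
  exact: chart_image_open.
Qed.

Lemma smooth_on_mul W f g : open W -> smooth_on W f -> smooth_on W g ->
  smooth_on W (fun q => f q * g q).
Proof.
by move=> oW sf sg c ac k; apply: Ck_mul (sf c ac k) (sg c ac k);
  exact: chart_image_open.
Qed.

(* One chart suffices to test smoothness, because transition maps are smooth. *)
Lemma smooth_on_chart W c f : open W -> atlas c -> W `<=` chart_dom c ->
  Cinf (chart_map c @` W) (f \o chart_inv c) -> smooth_on W f.
Proof.
move=> oW ac Wc sf d ad k; have oWd := chart_image_open (c := d) oW.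
apply: (@Ck_ext _ _ _ _ ((f \o chart_inv c) \o
  (chart_map c \o chart_inv d))) => //.
  by move=> _ [x [Wx dx] <-] /=; rewrite !chart_mapK//; exact: Wc.
move: k; apply: Cinf_comp sf => //.
  by move=> _ [x [Wx dx] <-] /=; rewrite chart_mapK//; exists x.
move=> j k; apply: Ck_sub (transition_smooth j ad ac k).
by apply: image_subset => x [/Wc].
Qed.

Lemma smooth_on_coord c (j : 'I_n) : atlas c ->
  smooth_on (chart_dom c) (fun q => chart_map c q 0 j).
Proof. by move=> ac d ad; rewrite setIC; exact: transition_smooth. Qed.

Lemma smooth_on_at W f p : open W -> W p -> smooth_on W f -> smooth_at p f.
Proof. by move=> oW Wp sf; exists W. Qed.

Lemma smooth_at_ext p f g : (\near p, f p = g p) -> smooth_at p f -> smooth_at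
  p g.
Proof.
move=> /near_open[ O [ oO Op fg]] [W [ oW Wp sf]]; exists (W `&` O); split=> //.
  exact: openI.
apply: smooth_on_ext (smooth_on_sub (@subIsetl _ W O) sf); first exact: openI.
by move=> q [_ /fg].
Qed.

Lemma smooth_at_add p f g : smooth_at p f -> smooth_at p g ->
  smooth_at p (fun q => f q + g q).
Proof.
move=> [W [ oW Wp sf]] [ O [ oO Op sg]]; exists (W `&` O); split=> //.
  exact: openI.
by apply: smooth_on_add; [exact: openI|exact: smooth_on_sub sf|exact:
  smooth_on_sub sg].
Qed.

Lemma smooth_at_mul p f g : smooth_at p f -> smooth_at p g ->
  smooth_at p (fun q => f q * g q).
Proof.
move=> [W [ oW Wp sf]] [ O [ oO Op sg]]; exists (W `&` O); split=> //.
  exact: openI.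
by apply: smooth_on_mul; [exact: openI|exact: smooth_on_sub sf|exact:
  smooth_on_sub sg].
Qed.

Lemma smooth_at_cst p (a : R) : smooth_at p (fun=> a).
Proof. by exists setT; split=> //; [exact: openT|exact: smooth_on_cst]. Qed.

Lemma smooth_at_sum p (I : Type) (s : seq I) (F : I -> M -> R) :
  (forall i, smooth_at p (F i)) -> smooth_at p (fun q => \sum_(i <- s) F i q).
Proof.
move=> sF; elim: s => [|i s IH].
  by apply: smooth_at_ext (smooth_at_cst p 0); near=> q; rewrite big_nil.
by apply: smooth_at_ext (smooth_at_add (sF i) IH); near=> q; rewrite big_cons.
Unshelve. all: by end_near. Qed.

Lemma smooth_at_chart p c f : atlas c -> chart_dom c p -> smooth_at p f ->
  differentiable (f \o chart_inv c) (chart_map c p).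
Proof.
move=> ac cp [W [ oW Wp sf]]; apply: Cinf_differentiable (sf c ac) _.
by exists p.
Qed.

Lemma near_chart p c f g : chart_dom c p -> (\near p, f p = g p) ->
  \forall z \near chart_map c p, (f \o chart_inv c) z = (g \o chart_inv c) z.
Proof.
move=> cp; move=> /near_open[ O [ oO Op fg]].
apply: (open_nearS (chart_image_open (c := c) oO)); first by exists p.
by move=> _ [x [Ox cx] <-] /=; rewrite chart_mapK//; exact: fg.
Qed.

End Charts.

(** * Tangent vectors and coordinate fields *)

Section Tangent.
Context {R : realType} {n : nat} {M : manifold R n}.
Implicit Types (c d : chart R n M) (W O : set M) (f g : M -> R) (p q : M)
  (v u : functional M).

Lemma smooth_at_extE p f g : (\near p, f p = g p) ->
  `[< smooth_at p f >] = `[< smooth_at p g >].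
Proof.
move=> fg; apply: asbool_equiv_eq; split; apply: smooth_at_ext => //.
by apply: filterS fg.
Qed.

Lemma tangent_nsmooth p v f : tangent p v -> ~ smooth_at p f -> v f = 0.
Proof. by move=> [c [_ _ [a ->]]] nf; rewrite asboolF. Qed.

Lemma tangent_cst p v (a : R) : tangent p v -> v (fun=> a) = 0.
Proof.
move=> [c [ac cp [b vE]]]; rewrite vE asboolT; last exact: smooth_at_cst.
exact: derive_cst.
Qed.

(** Also true for functions not smooth at [p]: smoothness at [p] is itself a property of the germ,
    so both sides then take the default value 0. *)
Lemma tangent_ext p v f g : tangent p v -> (\near p, f p = g p) -> v f = v g.
Proof.
move=> [c [ac cp [a vE]]] fg; rewrite !vE (smooth_at_extE fg).
by case: ifP => // _; apply/near_eq_derive/near_chart.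
Qed.

(** The constant-coefficient field sum_i a_i d/dx_i of the chart. The default 0 is the one built
    into [tangent], so tangent vectors at [p] are exactly values of such fields. *)
Definition coord_field c (a : 'rV[R]_n) : field M := fun q f =>
  if `[< smooth_at q f >] then 'D_a (f \o chart_inv c) (chart_map c q) else 0.

Lemma tangentP p v : tangent p v <->
  exists c, [/\ atlas c, chart_dom c p & exists a, v = coord_field c a p].
Proof.
split=> -[c [ac cp [a vE]]]; exists c; split=> //; exists a; first exact/funext.
by rewrite vE.
Qed.

Lemma coord_field_tangent c a q : atlas c -> chart_dom c q ->
  tangent q (coord_field c a q).
Proof. by move=> ac cq; exists c; split=> //; exists a. Qed.

Lemma coord_field_lin c (s : R) a b q : atlas c -> chart_dom c q ->
  coord_field c (s *: a + b) q = s *: coord_field c a q + coord_field c b q.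
Proof.
move=> ac cq; apply/funext => f.
rewrite -[RHS]/(s * coord_field c a q f + coord_field c b q f) /coord_field.
case: asboolP => [sf|_]; last by rewrite mulr0 addr0.
by have df := smooth_at_chart ac cq sf; rewrite !deriveE// linearP.
Qed.

Lemma coord_field0 c q : coord_field c 0 q = 0.
Proof.
apply/funext => f; rewrite /coord_field derive0. by rewrite if_same.
Qed.

Lemma coord_field_smooth c a W f : open W -> atlas c -> W `<=` chart_dom c ->
  smooth_on W f -> smooth_on W (app (coord_field c a) f).
Proof.
move=> oW ac Wc sf; apply: (smooth_on_chart oW ac Wc).
have WE : W `&` chart_dom c = W by apply/seteqP; split=> [x []//|x Wx];
  split=> //; exact: Wc.
have oc : open (chart_map c @` W).
  by rewrite -WE; exact: chart_image_open.
have Cf : Cinf (chart_map c @` W) (f \o chart_inv c).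
  by have := sf c ac; rewrite WE.
move=> k; apply: Ck_ext (Cinf_derive a oc Cf k) => // _ [x Wx <-] /=.
rewrite /app /coord_field chart_mapK; last exact: Wc.
by rewrite asboolT//; exact: smooth_on_at sf.
Qed.

End Tangent.

(** * The differential of a smooth map *)

Section Dmap.
Context {R : realType} {m n : nat} {M : manifold R m} {B : manifold R n}.
Variable phi : M -> B.
Hypothesis sphi : smooth_map phi.

Lemma open_preimage (O : set B) : open O -> open (phi @^-1` O).
Proof. by move=> oO; apply: open_comp => // x _; case: sphi => c _;
  exact: c. Qed.

Lemma smooth_at_comp p f : smooth_at (phi p) f -> smooth_at p (f \o phi).
Proof.
move=> [W [oW Wp sf]]; exists (phi @^-1` W); split=> //;
  first exact: open_preimage.
by case: sphi => _; apply.
Qed.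

Lemma near_comp p (P : B -> Prop) :
  (\forall b \near phi p, P b) -> \forall q \near p, P (phi q).
Proof. by case: sphi => c _; apply: c. Qed.

(** The chain rule in charts. The coefficients are [v] applied to pulled-back coordinates, a form
    that visibly varies smoothly when [v] runs through a smooth field. *)
Lemma dmap_coord p v (d : chart R n B) : tangent p v -> atlas d ->
  chart_dom d (phi p) ->
  dmap phi p v = coord_field d (\row_j v (fun q => chart_map d (phi q) 0 j))
    (phi p).
Proof.
move=> tv ad dp; apply/funext => f; rewrite /dmap /coord_field.
case: asboolP => // sf; have [c [ac cp [a vE]]] := tv.
have scoord j : smooth_at p (fun q => chart_map d (phi q) 0 j).
  apply: (smooth_at_comp (f := fun q => chart_map d q 0 j)).
  by exists (chart_dom d); split=> //; [exact: chart_dom_open|exact: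
    smooth_on_coord].
rewrite vE asboolT; last exact: smooth_at_comp.
pose psi := chart_map d \o phi \o chart_inv c.
have dpsi j : differentiable (fun y => psi y 0 j) (chart_map c p).
  exact: smooth_at_chart (scoord j).
have psip : psi (chart_map c p) = chart_map d
  (phi p) by rewrite /psi/= chart_mapK.
have df : differentiable (f \o chart_inv d) (psi (chart_map c p)).
  by rewrite psip; exact: smooth_at_chart.
rewrite (@near_eq_derive _ _ _ _ ((f \o chart_inv d) \o psi)).
  have [_ ->] := chain_rule a dpsi df; rewrite psip; congr ('D_ _ _ _).
  by apply/rowP => j; rewrite !mxE vE asboolT.
have oW := open_preimage (chart_dom_open d).
apply: (open_nearS (chart_image_open (c := c) oW)); first by exists p.
by move=> _ [x [Wx cx] <-] /=; rewrite !chart_mapK.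
Qed.

Lemma dmap_tangent p v : tangent p v -> tangent (phi p) (dmap phi p v).
Proof.
move=> tv; have [d ad dp] := chart_at (phi p).
by rewrite (dmap_coord tv ad dp); exact: coord_field_tangent.
Qed.

Lemma dmap_lin p (s : R) (u v : functional M) :
  dmap phi p (s *: u + v) = s *: dmap phi p u + dmap phi p v.
Proof.
apply/funext => f.
rewrite -[RHS]/(s * dmap phi p u f + dmap phi p v f) /dmap.
by case: ifP => // _; rewrite mulr0 addr0.
Qed.

End Dmap.

Section TangentLin.
Context {R : realType} {n : nat} {M : manifold R n}.

Lemma smooth_map_id : smooth_map (@id M).
Proof. by split=> // x; exact: cvg_id. Qed.

Lemma dmap_id (p : M) v : tangent p v -> dmap id p v = v.
Proof.
move=> tv; apply/funext => f; rewrite /dmap.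
by case: asboolP => // nf; rewrite (tangent_nsmooth tv nf).
Qed.

(** Change of charts, read off from the differential of the identity. It puts two tangent vectors,
    each given in its own chart, into a common one, and so makes the tangent space a linear
    subspace. *)
Lemma tangent_coordE (p : M) v (c : chart R n M) : tangent p v -> atlas c ->
  chart_dom c p -> v = coord_field c (\row_j v (fun q => chart_map c q 0 j)) p.
Proof.
by move=> tv ac cp; rewrite -[LHS](dmap_id tv)
  (dmap_coord smooth_map_id tv ac cp).
Qed.

Lemma tangent_lin (p : M) (s : R) u v : tangent p u -> tangent p v ->
  tangent p (s *: u + v).
Proof.
move=> tu tv; have [c ac cp] := chart_at p.
rewrite (tangent_coordE tu ac cp) (tangent_coordE tv ac cp) -coord_field_lin//.
exact: coord_field_tangent.
Qed.

Lemma tangent0 (p : M) : tangent p 0.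
Proof.
have [c ac cp] := chart_at p.
by rewrite -(coord_field0 c p); exact: coord_field_tangent.
Qed.

End TangentLin.

(** * Sections of distributions and metrics *)

Section Distributions.
Context {R : realType} {n : nat} {M : manifold R n}.
Implicit Types (D : distribution M) (W O : set M) (X Y : field M) (p q : M)
  (v u : functional M).

(** Shared by the tangent, vertical and horizontal distributions, so that connection theory is
    developed once and applied to total space, base and fibers. *)
Definition linear_distribution D : Prop :=
  [/\ forall p v, D p v -> tangent p v, forall p, D p 0 &
      forall p (s : R) u v, D p u -> D p v -> D p (s *: u + v)].

Lemma tangent_linear : linear_distribution (@tangent R n M).
Proof. by split=> // [p|p s u v]; [exact: tangent0|exact: tangent_lin]. Qed.

Section Fixed.
Variable D : distribution M.
Hypothesis linD : linear_distribution D.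

Lemma distT p v : D p v -> tangent p v. Proof. by case: linD => H _ _;
  exact: H. Qed.

Lemma dist0 p : D p 0. Proof. by case: linD. Qed.

Lemma distD p u v : D p u -> D p v -> D p (u + v).
Proof. by case: linD => _ _ H Du Dv; rewrite -[u]scale1r; exact: H. Qed.

Lemma distZ p (s : R) v : D p v -> D p (s *: v).
Proof. by case: linD => _ H0 H Dv; rewrite -[_ *: v]addr0; exact: H. Qed.

Lemma distN p v : D p v -> D p (- v).
Proof. by move=> Dv; rewrite -scaleN1r; exact: distZ. Qed.

Lemma distB p u v : D p u -> D p v -> D p (u - v).
Proof. by move=> Du Dv; apply/distD/distN. Qed.

Lemma dist_sum p (I : Type) (s : seq I) (F : I -> functional M) :
  (forall i, D p (F i)) -> D p (\sum_(i <- s) F i).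
Proof. by move=> DF; apply: big_rec => [|i v _];
  [exact: dist0|exact: distD]. Qed.

Lemma section_on_sub W O X : O `<=` W -> section_on D W X -> section_on D O X.
Proof.
by move=> OW [DX sX]; split=> [q /OW /DX//|O' f oO' /subset_trans/(_ OW) O'W];
  exact: sX.
Qed.

Lemma section_on_ext W X Y : open W -> (forall q, W q -> X q = Y q) ->
  section_on D W X -> section_on D W Y.
Proof.
move=> oW XY [DX sX]; split=> [q Wq|O f oO OW sf]; first by rewrite -XY//;
  exact: DX.
by apply: smooth_on_ext (sX O f oO OW sf) => // q /OW Wq; rewrite /app XY.
Qed.

Lemma section_on0 W : section_on D W 0.
Proof. by split=> [q _|O f oO OW sf]; [exact: dist0|exact: smooth_on_cst]. Qed.

Lemma section_on_add W X Y : open W -> section_on D W X -> section_on D W Y ->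
  section_on D W (X + Y).
Proof.
move=> oW [DX sX] [DY sY]; split=> [q Wq|O f oO OW sf].
  by apply: distD; [exact: DX|exact: DY].
by apply: smooth_on_add => //; [exact: sX|exact: sY].
Qed.

Lemma section_on_scale W h X : open W -> smooth_on W h -> section_on D W X ->
  section_on D W (scale_field h X).
Proof.
move=> oW sh [DX sX]; split=> [q Wq|O f oO OW sf]; first by apply/distZ/DX.
by apply: smooth_on_mul => //; [exact: smooth_on_sub sh|exact: sX].
Qed.

Lemma section_on_at W p X : open W -> W p -> section_on D W X -> section_at D
  p X.
Proof. by move=> oW Wp sX; exists W. Qed.

Lemma section_value p X : section_at D p X -> D p (X p).
Proof. by move=> [W [ oW Wp [DX _]]]; exact: DX. Qed.

Lemma section_near p X : section_at D p X -> \forall q \near p, section_at D q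
  X.
Proof.
move=> [W [ oW Wp sX]]; apply: (open_nearS oW Wp) => q Wq.
exact: section_on_at sX.
Qed.

Lemma section_at2 p X Y : section_at D p X -> section_at D p Y ->
  exists W, [/\ open W, W p, section_on D W X & section_on D W Y].
Proof.
move=> [W [ oW Wp sX]] [ O [ oO Op sY]]; exists (W `&` O); split=> //.
- exact: openI.
- exact: section_on_sub sX.
- exact: section_on_sub sY.
Qed.

Lemma section_ext p X Y : (\near p, X p = Y p) -> section_at D p X ->
  section_at D p Y.
Proof.
move=> /near_open[ O [ oO Op XY]] [W [ oW Wp sX]]; exists (W `&` O); split=> //.
  exact: openI.
apply: section_on_ext (section_on_sub (@subIsetl _ W O) sX); first exact: openI.
by move=> q [_ /XY].
Qed.

Lemma section0 p : section_at D p 0.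
Proof. by exists setT; split=> //; [exact: openT|exact: section_on0]. Qed.

Lemma section_add p X Y : section_at D p X -> section_at D p Y ->
  section_at D p (X + Y).
Proof.
move=> sX sY; have [W [ oW Wp sX' sY']] := section_at2 sX sY.
by exists W; split=> //; exact: section_on_add.
Qed.

Lemma section_scale p h X : smooth_at p h -> section_at D p X ->
  section_at D p (scale_field h X).
Proof.
move=> [ O [ oO Op sh]] [W [ oW Wp sX]]; exists (W `&` O); split=> //.
  exact: openI.
apply: section_on_scale; [exact: openI|exact: smooth_on_sub sh|exact:
  section_on_sub sX].
Qed.

Lemma section_opp p X : section_at D p X -> section_at D p (- X).
Proof.
move=> sX; apply: section_ext (section_scale (smooth_at_cst p (-1)) sX).
by near=> q; rewrite /scale_field scaleN1r.
Unshelve. all: by end_near. Qed.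

Lemma section_sub p X Y : section_at D p X -> section_at D p Y ->
  section_at D p (X - Y).
Proof. by move=> sX sY; apply/section_add/section_opp. Qed.

Lemma section_sum p (I : Type) (s : seq I) (F : I -> field M) :
  (forall i, section_at D p (F i)) -> section_at D p (\sum_(i <- s) F i).
Proof.
by move=> sF; apply: big_rec => [|i X _ sX];
  [exact: section0|exact: section_add].
Qed.

End Fixed.

Lemma section_on_mono D (D' : distribution M) W X :
  (forall p v, D p v -> D' p v) -> section_on D W X -> section_on D' W X.
Proof. by move=> DD' [DX sX]; split=> // q /DX /DD'. Qed.

Lemma section_mono D (D' : distribution M) p X :
  (forall p v, D p v -> D' p v) -> section_at D p X -> section_at D' p X.
Proof. by move=> DD' [W [ oW Wp sX]]; exists W; split=> //;
  exact: section_on_mono sX. Qed.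

Lemma field_smooth_at p X f : section_at
  (@tangent R n M) p X -> smooth_at p f ->
  smooth_at p (app X f).
Proof.
move=> [W [ oW Wp [_ sX]]] [ O [ oO Op sf]]; exists (W `&` O); split=> //.
  exact: openI.
by apply: sX; [exact: openI|exact: subIsetl|exact: smooth_on_sub sf].
Qed.

End Distributions.

Section Metric.
Context {R : realType} {n : nat} {M : manifold R n} (g : metric M).
Implicit Types (p q : M) (u v w : functional M).

Let lT := @tangent_linear R n M.

Lemma metricC p u v : tangent p u -> tangent p v -> g p u v = g p v u.
Proof. by case: g => ? H ? ? ? tu tv; exact: H. Qed.

Lemma metric_linl p (s : R) u v w : tangent p u -> tangent p v -> tangent p w ->
  g p (s *: u + v) w = s * g p u w + g p v w.
Proof. by case: g => ? ? H ? ? tu tv tw; exact: H. Qed.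

Lemma metric_gt0 p v : tangent p v -> v != 0 -> 0 < g p v v.
Proof. by case: g => ? ? ? H ? tv v0; exact: H. Qed.

Lemma metric0l p w : tangent p w -> g p 0 w = 0.
Proof.
move=> tw; have t0 := tangent0 p.
by have := metric_linl 1 t0 t0 tw; rewrite scaler0 addr0 mul1r => /eqP; lra.
Qed.

Lemma metricDl p u v w : tangent p u -> tangent p v -> tangent p w ->
  g p (u + v) w = g p u w + g p v w.
Proof. by move=> tu tv tw; rewrite -[u]scale1r metric_linl// scale1r mul1r. Qed.

Lemma metricZl p (s : R) v w : tangent p v -> tangent p w ->
  g p (s *: v) w = s * g p v w.
Proof.
by move=> tv tw; rewrite -[_ *: v]addr0 metric_linl// ?metric0l ?addr0//;
  exact: tangent0.
Qed.

Lemma metricNl p v w : tangent p v -> tangent p w -> g p (- v) w = - g p v w.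
Proof. by move=> tv tw; rewrite -scaleN1r metricZl// mulN1r. Qed.

Lemma metricBl p u v w : tangent p u -> tangent p v -> tangent p w ->
  g p (u - v) w = g p u w - g p v w.
Proof. by move=> tu tv tw; rewrite metricDl ?metricNl//; exact: (distN lT). Qed.

Lemma metric_suml p (I : Type) (s : seq I) (F : I -> functional M) w :
  (forall i, tangent p (F i)) -> tangent p w ->
  g p (\sum_(i <- s) F i) w = \sum_(i <- s) g p (F i) w.
Proof.
move=> tF tw; elim: s => [|i s IH]; first by rewrite !big_nil metric0l.
by rewrite !big_cons metricDl ?IH//; exact: (dist_sum lT).
Qed.

Lemma metric0r p w : tangent p w -> g p w 0 = 0.
Proof. by move=> tw; rewrite metricC ?metric0l//; exact: tangent0. Qed.

Lemma metricDr p u v w : tangent p u -> tangent p v -> tangent p w ->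
  g p w (u + v) = g p w u + g p w v.
Proof.
move=> tu tv tw; rewrite metricC//; last exact: (distD lT).
by rewrite metricDl// !(metricC tw).
Qed.

Lemma metricZr p (s : R) v w : tangent p v -> tangent p w ->
  g p w (s *: v) = s * g p w v.
Proof.
move=> tv tw; rewrite metricC//; last exact: (distZ lT).
by rewrite metricZl// (metricC tw).
Qed.

Lemma metricNr p v w : tangent p v -> tangent p w -> g p w (- v) = - g p w v.
Proof. by move=> tv tw; rewrite -scaleN1r metricZr// mulN1r. Qed.

Lemma metric_sumr p (I : Type) (s : seq I) (F : I -> functional M) w :
  (forall i, tangent p (F i)) -> tangent p w ->
  g p w (\sum_(i <- s) F i) = \sum_(i <- s) g p w (F i).
Proof.
move=> tF tw; rewrite metricC//; last exact: (dist_sum lT).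
by rewrite metric_suml//; apply: eq_bigr => i _; rewrite metricC.
Qed.

Lemma metric_eq0 p v : tangent p v -> g p v v = 0 -> v = 0.
Proof. by move=> tv gv; apply/eqP; apply: contraT => /(metric_gt0 tv);
  rewrite gv ltxx. Qed.

Lemma metric_smooth_at p X Y : section_at (@tangent R n M) p X ->
  section_at (@tangent R n M) p Y -> smooth_at p (fun q => g q (X q) (Y q)).
Proof.
move=> sX sY; have [W [ oW Wp sX' sY']] := section_at2 sX sY.
by exists W; split=> //; case: g => ? ? ? ? H; exact: H.
Qed.

End Metric.

(** * Levi-Civita connections of distributions *)

Section LeviCivita.
Context {R : realType} {n : nat} {M : manifold R n} (g : metric M).
Variables (D : distribution M) (nabla : connection M).
Hypothesis linD : linear_distribution D.
Hypothesis lc : levi_civita g D nabla.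
Implicit Types (p q : M) (u v w : functional M) (X Y Z : field M).

Let dT p v : D p v -> tangent p v. Proof. exact: distT. Qed.

Lemma lc_in p v Y : D p v -> section_at D p Y -> D p (nabla p v Y).
Proof. by case: lc => -[H *]; exact: H. Qed.

Lemma lc_lin p (a : R) u v Y : D p u -> D p v -> section_at D p Y ->
  nabla p (a *: u + v) Y = a *: nabla p u Y + nabla p v Y.
Proof. by case: lc => -[? H *]; exact: H. Qed.

Lemma lc_add p v Y Z : D p v -> section_at D p Y -> section_at D p Z ->
  nabla p v (Y + Z) = nabla p v Y + nabla p v Z.
Proof. by case: lc => -[? ? H *]; exact: H. Qed.

Lemma lc_leibniz p v f Y : D p v -> smooth_at p f -> section_at D p Y ->
  nabla p v (scale_field f Y) = v f *: Y p + f p *: nabla p v Y.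
Proof. by case: lc => -[? ? ? H *]; exact: H. Qed.

Lemma lc_metric p v Y Z : D p v -> section_at D p Y -> section_at D p Z ->
  v (fun q => g q (Y q) (Z q)) = g p (nabla p v Y) (Z p) + g p (Y p)
    (nabla p v Z).
Proof. by case: lc => _ [H _]; exact: H. Qed.

Lemma lc_torsion p X Y : section_at D p X -> section_at D p Y ->
  lie X Y p = cov nabla X Y p - cov nabla Y X p.
Proof. by case: lc => _ [_ H] sX sY; rewrite H. Qed.

Lemma lc_cov_section p X Y : section_at D p X -> section_at D p Y ->
  section_at D p (cov nabla X Y).
Proof.
move=> sX sY; have [W [ oW Wp sX' sY']] := section_at2 sX sY.
by exists W; split=> //; case: lc => -[? ? ? ? H] _; exact: H.
Qed.

Lemma lc_cov_in p X Y : section_at D p X -> section_at D p Y ->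
  D p (cov nabla X Y p).
Proof. by move=> sX sY; exact: lc_in (section_value sX) sY. Qed.

(* A function need only be smooth near p, so a field vanishing near p is the
   multiple of itself by a function equal to 0 near p and to 1 elsewhere. *)
Lemma lc_near0 p v Y : D p v -> (\near p, Y p = 0) -> nabla p v Y = 0.
Proof.
move=> Dv Y0; pose f q : R := if `[< Y q = 0 >] then 0 else 1.
have f0 : \near p, f p = 0 by apply: filterS Y0 => q Yq; rewrite /f asboolT.
have sf : smooth_at p f.
  have f0' : \near p, 0 = f p by near do apply/esym.
  exact: smooth_at_ext f0' (smooth_at_cst p 0).
have YE : Y = scale_field f Y.
  apply/funext => q; rewrite /scale_field /f.
  by case: asboolP => [->|_]; rewrite ?scaler0 ?scale1r.
have sY : section_at D p Y.
  have Y0' : \near p, 0 = Y p by near do apply/esym.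
  exact: section_ext Y0' (section0 linD p).
rewrite YE lc_leibniz// (nbhs_singleton f0) scale0r addr0.
by rewrite (tangent_ext (dT Dv) f0) (tangent_cst _ (dT Dv)) scale0r.
Unshelve. all: by end_near. Qed.

(** Write [Z] as [Y] plus a field vanishing near [p], whose derivative is 0. *)
Lemma lc_local p v Y Z : D p v -> section_at D p Y -> (\near p, Y p = Z p) ->
  nabla p v Y = nabla p v Z.
Proof.
move=> Dv sY YZ; have sZ : section_at D p Z by exact: section_ext sY.
rewrite -[Z](subrK Y) addrC lc_add//; last exact: section_sub.
rewrite [X in _ = _ + X]lc_near0 ?addr0//.
by apply: filterS YZ => q YZq; rewrite /GRing.add/= -[LHS]/(Z q - Y q) YZq
  subrr.
Qed.

Lemma lcDl p u v Y : D p u -> D p v -> section_at D p Y ->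
  nabla p (u + v) Y = nabla p u Y + nabla p v Y.
Proof. by move=> Du Dv sY; rewrite -[u]scale1r lc_lin// !scale1r. Qed.

Lemma lc0l p Y : section_at D p Y -> nabla p 0 Y = 0.
Proof.
move=> sY; apply: (@addrI _ (nabla p 0 Y)).
by rewrite -lcDl ?addr0//; exact: (dist0 linD).
Qed.

Lemma lcZl p (a : R) v Y : D p v -> section_at D p Y ->
  nabla p (a *: v) Y = a *: nabla p v Y.
Proof.
by move=> Dv sY; rewrite -[_ *: v]addr0 lc_lin// ?lc0l ?addr0//;
  exact: (dist0 linD).
Qed.

Lemma lc_suml p (I : Type) (s : seq I) (F : I -> functional M) Y :
  (forall i, D p (F i)) -> section_at D p Y ->
  nabla p (\sum_(i <- s) F i) Y = \sum_(i <- s) nabla p (F i) Y.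
Proof.
move=> DF sY; elim: s => [|i s IH]; first by rewrite !big_nil lc0l.
by rewrite !big_cons lcDl ?IH//; exact: (dist_sum linD).
Qed.

Lemma lc_sumr p v (I : Type) (s : seq I) (F : I -> field M) :
  D p v -> (forall i, section_at D p (F i)) ->
  nabla p v (\sum_(i <- s) F i) = \sum_(i <- s) nabla p v (F i).
Proof.
move=> Dv sF; elim: s => [|i s IH].
  by rewrite !big_nil lc_near0//; near=> q.
by rewrite !big_cons lc_add ?IH//; exact: (section_sum linD).
Unshelve. all: by end_near. Qed.

Lemma lie_in p X Y : section_at D p X -> section_at D p Y -> D p (lie X Y p).
Proof. by move=> sX sY; rewrite lc_torsion//;
  exact: (distB linD (lc_cov_in sX sY) (lc_cov_in sY sX)). Qed.

(** Metric compatibility and torsion-freeness expand the right-hand side, which involves only metric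
    and brackets. Stated for any distribution, it compares the connection of the total space both
    with that of the base and with that of the fibers. *)
Lemma koszul p X Y Z : section_at D p X -> section_at D p Y -> section_at D p
  Z ->
  2 * g p (cov nabla X Y p) (Z p) =
  X p (fun q => g q (Y q) (Z q)) + Y p (fun q => g q (X q) (Z q))
  - Z p (fun q => g q (X q) (Y q)) + g p (lie X Y p) (Z p)
  - g p (lie X Z p) (Y p) - g p (lie Y Z p) (X p).
Proof.
move=> sX sY sZ.
have [dX dY dZ] := And3 (section_value sX) (section_value sY)
  (section_value sZ).
have [tX tY tZ] := And3 (dT dX) (dT dY) (dT dZ).
have tc U V : section_at D p U -> section_at D p V -> tangent p
  (cov nabla U V p).
  by move=> sU sV; apply/dT/lc_cov_in.
have tXY := tc _ _ sX sY; have tXZ := tc _ _ sX sZ; have tYX := tc _ _ sY sX.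
have tYZ := tc _ _ sY sZ; have tZX := tc _ _ sZ sX; have tZY := tc _ _ sZ sY.
rewrite (lc_metric dX sY sZ) (lc_metric dY sX sZ) (lc_metric dZ sX sY).
rewrite -![nabla p (_ p) _]/(cov nabla _ _ p) !lc_torsion// !metricBl//.
rewrite (metricC g tY tXZ) (metricC g tX tYZ) (metricC g tX tZY).
ring.
Qed.

End LeviCivita.

Lemma field_sumE (R : realType) n (M : manifold R n) (I : Type) (s : seq I)
    (F : I -> field M) q : (\sum_(i <- s) F i) q = \sum_(i <- s) F i q.
Proof. by elim: s => [|i s IH]; rewrite ?big_nil// !big_cons -IH. Qed.

(** * Orthonormal frames and orthogonal projections *)

Section Frame.
Context {R : realType} {n : nat} {M : manifold R n} (g : metric M).
Variables (D : distribution M) (k : nat) (F : 'I_k -> field M).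
Hypothesis linD : linear_distribution D.

Lemma frame_near p : orthonormal_frame_at g D p F ->
  \forall q \near p, orthonormal_frame_at g D q F.
Proof.
move=> [W [ oW Wp fr]]; apply: (open_nearS oW Wp) => q Wq.
by exists W.
Qed.

Lemma frame_section p i : orthonormal_frame_at g D p F -> section_at D p (F i).
Proof. by move=> [W [ oW Wp [sF _ _]]]; exists W. Qed.

Lemma frame_in p i : orthonormal_frame_at g D p F -> D p (F i p).
Proof. by move=> /(frame_section i)/section_value. Qed.

Lemma frame_tangent p i : orthonormal_frame_at g D p F -> tangent p (F i p).
Proof. by move=> /(frame_in i)/(distT linD). Qed.

Lemma frame_orth p i j : orthonormal_frame_at g D p F ->
  g p (F i p) (F j p) = (i == j)%:R.
Proof. by move=> [W [ oW Wp [_ oF _]]]; exact: oF. Qed.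

Lemma metric_frame_sum p (a : 'I_k -> R) j : orthonormal_frame_at g D p F ->
  g p (\sum_i a i *: F i p) (F j p) = a j.
Proof.
move=> fr; have tF i : tangent p (F i p) by exact: frame_tangent fr.
rewrite metric_suml//; last by move=> i; exact/(distZ tangent_linear).
rewrite (bigD1 j)//= metricZl// frame_orth// eqxx mulr1 big1 ?addr0// => i ij.
by rewrite metricZl// frame_orth// (negbTE ij) mulr0.
Qed.

Lemma frame_expand p v : orthonormal_frame_at g D p F -> D p v ->
  v = \sum_i g p v (F i p) *: F i p.
Proof.
move=> fr Dv; have [a vE] : exists a, v = \sum_i a i *: F i p.
  by move: fr => [W [ oW Wp [_ _ H]]]; exact: H.
rewrite {1}vE; apply: eq_bigr => i _; congr (_ *: _).
by rewrite vE metric_frame_sum.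
Qed.

Lemma metric_frame p v w : orthonormal_frame_at g D p F -> D p v -> tangent p
  w ->
  g p v w = \sum_i g p v (F i p) * g p w (F i p).
Proof.
move=> fr Dv tw; have tF i : tangent p (F i p) by exact: frame_tangent fr.
rewrite {1}(frame_expand fr Dv) metric_suml//.
  by apply: eq_bigr => i _; rewrite metricZl// (metricC g tw).
by move=> i; exact/(distZ tangent_linear).
Qed.

Lemma sqnorm_frame p v : orthonormal_frame_at g D p F -> D p v ->
  sqnorm g p v = \sum_i g p v (F i p) ^+ 2.
Proof.
move=> fr Dv; rewrite /sqnorm {1}(metric_frame fr Dv (distT linD Dv)).
by apply: eq_bigr => i _; rewrite expr2.
Qed.

(** Constant coefficients in the frame give the extension; no bump function is involved, since
    sections are only constrained near [p]. *)
Lemma dist_extend p v : orthonormal_frame_at g D p F -> D p v ->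
  exists2 Y, section_at D p Y & Y p = v.
Proof.
move=> fr Dv; pose a i := g p v (F i p).
exists (\sum_i scale_field (fun=> a i) (F i)).
  by apply: (section_sum linD) => i; apply: (section_scale linD);
    [exact: smooth_at_cst|exact: frame_section].
by rewrite field_sumE [RHS](frame_expand fr Dv).
Qed.

Lemma frame_project_section p Y : orthonormal_frame_at g D p F ->
  section_at (@tangent R n M) p Y ->
  section_at D p (fun q => \sum_i g q (Y q) (F i q) *: F i q).
Proof.
move=> fr sY.
rewrite (_ : (fun _ => _) = \sum_i scale_field (fun q => g q (Y q) (F i q))
  (F i)).
  apply: (section_sum linD) => i; apply: (section_scale linD).
    by apply: metric_smooth_at => //; apply: section_mono
      (frame_section i fr); exact: distT.
  exact: frame_section fr.
by apply/funext => q; rewrite field_sumE.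
Qed.

End Frame.

(** * Vertical and horizontal projections *)

Section Projections.
Context {R : realType} {m n : nat} {M : manifold R m} {B : manifold R n}.
Variables (g : metric M) (pi : M -> B).
Variables (r l : nat) (U : M -> 'I_r -> field M) (X : M -> 'I_l -> field M).
Hypothesis frV : forall p, orthonormal_frame_at g (vertical pi) p (U p).
Hypothesis frH : forall p, orthonormal_frame_at g (horizontal g pi) p (X p).

Notation ver := (vertical pi).
Notation hor := (horizontal g pi).
Notation tan := (@tangent R m M).

Lemma vertical_linear : linear_distribution ver.
Proof.
split=> [p v []//|p|p s u v [tu du] [tv dv]].
  split; [exact: tangent0|apply/funext => f].
  by rewrite /dmap; case: ifP.
split; [exact: tangent_lin|].
by rewrite dmap_lin du dv scaler0 addr0.
Qed.

Lemma horizontal_linear : linear_distribution hor.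
Proof.
split=> [p v []//|p|p s u v [tu du] [tv dv]].
  by split=> [|u [tu _]]; [exact: tangent0|rewrite metric0r].
split=> [|w vw]; first exact: tangent_lin.
have [tw _] := vw.
rewrite metricDr ?metricZr// ?du// ?dv// ?mulr0 ?addr0//.
exact: (distZ tangent_linear).
Qed.

Lemma ver_tan p v : ver p v -> tangent p v. Proof. by case. Qed.
Lemma hor_tan p v : hor p v -> tangent p v. Proof. by case. Qed.

Lemma metric_vh p u v : ver p u -> hor p v -> g p u v = 0.
Proof. by move=> vu [_ ->]. Qed.

Lemma metric_hv p u v : ver p u -> hor p v -> g p v u = 0.
Proof.
by move=> vu hv; rewrite metricC ?metric_vh//; [exact: hor_tan|exact: ver_tan].
Qed.

(** [vproj] is a choice; the witness [u] excludes its default value, and two candidates differ by a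
    vector both vertical and horizontal, hence orthogonal to itself. *)
Lemma vproj_uniq p u v : ver p u -> hor p (v - u) -> vproj g pi p v = u.
Proof.
move=> vu hu; rewrite /vproj.
case: xgetP => [w _ [vw hw]|/(_ u) []//].
have vd : ver p (w - u) by exact: (distB vertical_linear).
apply/subr0_eq; apply: (metric_eq0 (g := g) (ver_tan vd));
  apply: (metric_vh vd).
have -> : w - u = (v - u) - (v - w) by rewrite opprB [RHS]addrC addrA subrK.
exact: (distB horizontal_linear).
Qed.

(** Existence of the decomposition comes from the vertical frame: subtracting the frame expansion
    leaves a vector orthogonal to every vertical one. *)
Lemma projP p v : tangent p v -> ver p (vproj g pi p v) /\ hor p
  (hproj g pi p v).
Proof.
move=> tv; have fr := frV p; pose u := \sum_k g p v (U p k p) *: U p k p.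
have tU k : tangent p (U p k p) by exact: (frame_tangent vertical_linear k fr).
have vu : ver p u.
  by apply: (dist_sum vertical_linear) => k; apply: (distZ vertical_linear);
    exact: frame_in fr.
have hu : hor p (v - u).
  have tvu : tangent p (v - u) by apply: (distB tangent_linear) => //;
    exact: ver_tan.
  split=> // w vw; rewrite (metric_frame vertical_linear fr vw tvu) big1// =>
    k _.
  rewrite metricBl//; last exact: ver_tan.
  by rewrite (metric_frame_sum vertical_linear _ _ fr) subrr mulr0.
by rewrite /hproj (vproj_uniq vu hu).
Qed.

Lemma vproj_in p v : tangent p v -> ver p (vproj g pi p v).
Proof. by case/projP. Qed.

Lemma hproj_in p v : tangent p v -> hor p (hproj g pi p v).
Proof. by case/projP. Qed.

Lemma vproj_ver p v : ver p v -> vproj g pi p v = v.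
Proof. by move=> vv; apply: vproj_uniq => //; rewrite subrr;
  exact: (dist0 horizontal_linear). Qed.

Lemma vproj_hor p v : hor p v -> vproj g pi p v = 0.
Proof. by move=> hv; apply: vproj_uniq; rewrite ?subr0//;
  exact: (dist0 vertical_linear). Qed.

Lemma hproj_ver p v : ver p v -> hproj g pi p v = 0.
Proof. by move=> vv; rewrite /hproj vproj_ver// subrr. Qed.

Lemma hproj_hor p v : hor p v -> hproj g pi p v = v.
Proof. by move=> hv; rewrite /hproj vproj_hor// subr0. Qed.

Lemma proj_dec p v : v = vproj g pi p v + hproj g pi p v.
Proof. by rewrite /hproj addrC subrK. Qed.

Lemma metric_vproj p v w : tangent p v -> ver p w -> g p
  (vproj g pi p v) w = g p v w.
Proof.
move=> tv vw; have [vv hv] := projP tv.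
rewrite [in RHS](proj_dec p v) metricDl ?(metric_hv vw hv) ?addr0//;
  try exact: ver_tan.
exact: hor_tan.
Qed.

Lemma metric_hproj p v w : tangent p v -> hor p w -> g p
  (hproj g pi p v) w = g p v w.
Proof.
move=> tv hw; have [vv hv] := projP tv.
rewrite [in RHS](proj_dec p v) metricDl ?(metric_vh vv hw) ?add0r//;
  try exact: hor_tan.
exact: ver_tan.
Qed.

Lemma metric_split p v w : tangent p v -> tangent p w ->
  g p v w = g p (vproj g pi p v) (vproj g pi p w) + g p (hproj g pi p v)
    (hproj g pi p w).
Proof.
move=> tv tw; have [vw hw] := projP tw.
rewrite metric_vproj// metric_hproj// -metricDr -?proj_dec//.
  exact: ver_tan.
exact: hor_tan.
Qed.

Lemma horP p v : tangent p v -> (forall k, g p v (U p k p) = 0) -> hor p v.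
Proof.
move=> tv vU; split=> // w vw.
rewrite (metric_frame vertical_linear (frV p) vw tv) big1// => k _.
by rewrite vU mulr0.
Qed.

Lemma verP p v : tangent p v -> (forall i, g p v (X p i p) = 0) -> ver p v.
Proof.
move=> tv vX; have [vv hv] := projP tv.
suff h0 : hproj g pi p v = 0 by rewrite (proj_dec p v) h0 addr0.
rewrite (frame_expand horizontal_linear (frH p) hv) big1// => i _.
rewrite metric_hproj ?vX ?scale0r//.
exact: frame_in (frH p).
Qed.

(** [hproj] is defined pointwise by a choice, so smoothness is obtained from the expansion in the
    horizontal frame, with which it agrees near [p]. *)
Lemma hpart_section p Y : section_at tan p Y -> section_at hor p (hpart g pi Y).
Proof.
move=> sY; apply: section_ext (frame_project_section horizontal_linear
  (frH p) sY).
near=> q; have fr : orthonormal_frame_at g hor q (X p).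
  by near: q; apply: frame_near; exact: frH.
have tY : tangent q (Y q).
  by apply: section_value; near: q; exact: section_near.
rewrite /hpart [RHS](frame_expand horizontal_linear fr (hproj_in tY)).
apply: eq_bigr => k _; rewrite metric_hproj//.
exact: frame_in fr.
Unshelve. all: by end_near. Qed.

Lemma ver_sec_tan p Y : section_at ver p Y -> section_at tan p Y.
Proof. exact: section_mono ver_tan. Qed.

Lemma hor_sec_tan p Y : section_at hor p Y -> section_at tan p Y.
Proof. exact: section_mono hor_tan. Qed.

(** * O'Neill's tensors on vertical and horizontal sections *)

Section ONeill.
Variable nabla : connection M.
Hypothesis lc : levi_civita g tan nabla.

Let tl := @tangent_linear R m M.

Lemma cov_tangent p Y Z : section_at tan p Y -> section_at tan p Z ->
  tangent p (cov nabla Y Z p).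
Proof. exact: lc_cov_in lc _ _ _. Qed.

(** [V] is vertical only near [p], so its projections equal [V] and 0 only there; locality of the
    connection suffices. *)
Lemma nabla_vpart p v V : tangent p v -> section_at ver p V ->
  nabla p v (vpart g pi V) = nabla p v V /\ nabla p v (hpart g pi V) = 0.
Proof.
move=> tv sV; have nV : \forall q \near p, ver q (V q).
  by apply: filterS (section_near sV) => q; exact: section_value.
split; last first.
  by apply: (lc_near0 tl lc) => //; apply: filterS nV => q vV; exact: hproj_ver.
apply/esym/(lc_local tl lc) => //; first exact: ver_sec_tan.
by apply: filterS nV => q vV; rewrite /vpart vproj_ver.
Qed.

Lemma nabla_hpart p v Y : tangent p v -> section_at hor p Y ->
  nabla p v (hpart g pi Y) = nabla p v Y /\ nabla p v (vpart g pi Y) = 0.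
Proof.
move=> tv sY; have nY : \forall q \near p, hor q (Y q).
  by apply: filterS (section_near sY) => q; exact: section_value.
split; last first.
  by apply: (lc_near0 tl lc) => //; apply: filterS nY => q hY; exact: vproj_hor.
apply/esym/(lc_local tl lc) => //; first exact: hor_sec_tan.
by apply: filterS nY => q hY; rewrite /hpart hproj_hor.
Qed.

Let v0 p : vproj g pi p 0 = 0.
Proof. by apply: vproj_ver; exact: (dist0 vertical_linear). Qed.

Let h0 p : hproj g pi p 0 = 0.
Proof. by apply: hproj_ver; exact: (dist0 vertical_linear). Qed.

Lemma oneillT_ver p V W : section_at ver p V -> section_at ver p W ->
  oneillT g pi nabla V W p = hproj g pi p (cov nabla V W p).
Proof.
move=> sV sW; have vV := section_value sV;
  have [E1 E2] := nabla_vpart (ver_tan vV) sW.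
rewrite /oneillT /GRing.add /= /hpart /vpart /cov (vproj_ver vV).
by rewrite E1 E2 v0 addr0.
Qed.

Lemma oneillT_hor p V Y : section_at ver p V -> section_at hor p Y ->
  oneillT g pi nabla V Y p = vproj g pi p (cov nabla V Y p).
Proof.
move=> sV sY; have vV := section_value sV;
  have [E1 E2] := nabla_hpart (ver_tan vV) sY.
rewrite /oneillT /GRing.add /= /hpart /vpart /cov (vproj_ver vV).
by rewrite E1 E2 h0 add0r.
Qed.

Lemma oneillA_ver p Y V : section_at hor p Y -> section_at ver p V ->
  oneillA g pi nabla Y V p = hproj g pi p (cov nabla Y V p).
Proof.
move=> sY sV; have hY := section_value sY;
  have [E1 E2] := nabla_vpart (hor_tan hY) sV.
rewrite /oneillA /GRing.add /= /hpart /vpart /cov (hproj_hor hY).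
by rewrite E1 E2 v0 addr0.
Qed.

Lemma oneillA_hor p Y Z : section_at hor p Y -> section_at hor p Z ->
  oneillA g pi nabla Y Z p = vproj g pi p (cov nabla Y Z p).
Proof.
move=> sY sZ; have hY := section_value sY;
  have [E1 E2] := nabla_hpart (hor_tan hY) sZ.
rewrite /oneillA /GRing.add /= /hpart /vpart /cov (hproj_hor hY).
by rewrite E1 E2 h0 add0r.
Qed.

End ONeill.

End Projections.

(** * Basic fields and O'Neill's equation *)

Section CoordSection.
Context {R : realType} {n : nat} {M : manifold R n}.

Lemma coord_field_section (c : chart R n M) a p : atlas c -> chart_dom c p ->
  section_at (@tangent R n M) p (coord_field c a).
Proof.
move=> ac cp; exists (chart_dom c); split=> //; first exact: chart_dom_open.
split=> [q cq|O f oO Oc sf]; first exact: coord_field_tangent.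
exact: coord_field_smooth.
Qed.

Lemma coord_field_sum (c : chart R n M) a q : atlas c -> chart_dom c q ->
  coord_field c a q = \sum_j a 0 j *: coord_field c (delta_mx 0 j) q.
Proof.
move=> ac cq; rewrite {1}(row_sum_delta a).
elim: (index_enum _) => [|j s IH]; first by rewrite !big_nil coord_field0.
by rewrite !big_cons coord_field_lin// IH.
Qed.

End CoordSection.

(** * Horizontal lifts *)

Section Lift.
Context {R : realType} {m n : nat} {M : manifold R m} {B : manifold R n}.
Variables (g : metric M) (gB : metric B) (pi : M -> B).
Hypothesis sub : riemannian_submersion g gB pi.
Variables (r l : nat) (U : M -> 'I_r -> field M) (X : M -> 'I_l -> field M).
Hypothesis frV : forall p, orthonormal_frame_at g (vertical pi) p (U p).
Hypothesis frH : forall p, orthonormal_frame_at g (horizontal g pi) p (X p).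

Notation ver := (vertical pi).
Notation hor := (horizontal g pi).
Notation tan := (@tangent R m M).
Notation tanB := (@tangent R n B).

Lemma sub_smooth : smooth_map pi. Proof. by case: sub. Qed.

Lemma dmapT p v : tangent p v -> tangent (pi p) (dmap pi p v).
Proof. exact: dmap_tangent sub_smooth _ _. Qed.

Lemma dmapD p u v : dmap pi p (u + v) = dmap pi p u + dmap pi p v.
Proof. by rewrite -[u]scale1r dmap_lin !scale1r. Qed.

Lemma dmap_ver p v : ver p v -> dmap pi p v = 0. Proof. by case. Qed.

Lemma dmapB p u v : dmap pi p (u - v) = dmap pi p u - dmap pi p v.
Proof. by apply/eqP; rewrite eq_sym subr_eq -dmapD subrK. Qed.

Lemma dmap_hproj p v : tangent p v -> dmap pi p (hproj g pi p v) = dmap pi p v.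
Proof. by move=> tv; rewrite /hproj dmapB (dmap_ver
  (vproj_in frV tv)) subr0. Qed.

Lemma dmap_hor p u v : hor p u -> hor p v ->
  gB (pi p) (dmap pi p u) (dmap pi p v) = g p u v.
Proof. by case: sub => _ _ _ _; exact. Qed.

(** One horizontal argument is enough: the vertical part of [v] is lost on both sides. This is used
    for covariant derivatives of basic fields, which need not be horizontal. *)
Lemma dmap_metric p v z : tangent p v -> hor p z ->
  gB (pi p) (dmap pi p v) (dmap pi p z) = g p v z.
Proof.
move=> tv hz; rewrite -(dmap_hproj tv) dmap_hor//; last exact: (hproj_in frV).
exact: metric_hproj frV _ _ _ tv hz.
Qed.

Lemma dmap_surj p w : tangent (pi p) w -> exists2 h, hor p h & dmap pi p h = w.
Proof.
case: sub => _ _ _ H _ /H[v tv <-].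
by exists (hproj g pi p v); [exact: hproj_in frV _ _ tv|exact: dmap_hproj].
Qed.

Lemma dmap_inj p u v : hor p u -> hor p v -> dmap pi p u = dmap pi p v -> u = v.
Proof.
move=> hu hv uv; apply/subr0_eq.
have hd : hor p (u - v) by exact: (distB (horizontal_linear g pi)).
apply: (metric_eq0 (g := g) (hor_tan hd)); apply: (metric_vh _ hd).
by split; [exact: hor_tan hd|rewrite dmapB uv subrr].
Qed.

(** Expand d pi(Z) in the coordinate fields of a chart of the base. Its coefficients are [Z] applied
    to coordinates pulled back by [pi], and the remaining factors are pullbacks of smooth functions
    on the base. *)
Lemma lift_coef_smooth p Z Y : section_at tan p Z -> section_at tanB (pi p) Y ->
  smooth_at p (fun q => gB (pi q) (Y (pi q)) (dmap pi q (Z q))).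
Proof.
move=> sZ sY; have [d ad dp] := chart_at (pi p).
pose y j (b : B) := chart_map d b 0 j; pose e j := coord_field d (delta_mx 0 j).
have se j : section_at tanB (pi p) (e j) by exact: coord_field_section.
have sy j : smooth_at (pi p) (y j).
  by exists (chart_dom d); split=> //; [exact: chart_dom_open|exact:
    smooth_on_coord].
have ss := sub_smooth.
apply: (smooth_at_ext (f := fun q => \sum_j app Z (y j \o pi) q *
    ((fun b => gB b (Y b) (e j b)) \o pi) q)); last first.
  apply: smooth_at_sum => j; apply: smooth_at_mul.
    by apply: field_smooth_at => //; exact: smooth_at_comp.
  by apply: smooth_at_comp => //; exact: metric_smooth_at.
near=> q; have tZ : tangent q (Z q) by apply: section_value; near: q;
  exact: section_near.
have dq : chart_dom d (pi q).
  near: q; apply: (near_comp ss (P := chart_dom d)); apply: open_nbhs_nbhs;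
    split=> //.
  exact: chart_dom_open.
have tY : tangent (pi q) (Y (pi q)).
  apply: section_value; near: q; apply: (near_comp ss
    (P := fun b => section_at tanB b Y)); exact: section_near.
have te j : tangent (pi q) (e j (pi q)) by exact: coord_field_tangent.
rewrite (dmap_coord ss tZ ad dq) coord_field_sum// metric_sumr//.
  by apply: eq_bigr => j _; rewrite metricZr ?mxE//; exact: te.
by move=> j; apply: (distZ tangent_linear); exact: te.
Unshelve. all: by end_near. Qed.

Definition related (p : M) (Y : field M) (Y' : field B) : Prop :=
  \forall q \near p, dmap pi q (Y q) = Y' (pi q).

Definition basic (p : M) Y Y' : Prop :=
  [/\ section_at hor p Y, section_at tanB (pi p) Y' & related p Y Y'].

Lemma lift_exists p Y' : section_at tanB (pi p) Y' -> exists Y, basic p Y Y'.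
Proof.
(* If Y is the lift, isometry turns its frame coefficients g(Y, X_i) into gB(Y', d pi X_i), which
   are known beforehand. *)
move=> sY'; exists (\sum_i scale_field (fun q => gB (pi q) (Y' (pi q))
  (dmap pi q (X p i q))) (X p i)).
split=> //.
  apply: (section_sum (horizontal_linear g pi)) => i.
  apply: (section_scale (horizontal_linear g pi));
    last exact: frame_section (frH p).
  by apply: lift_coef_smooth => //; apply: hor_sec_tan;
    exact: frame_section (frH p).
near=> q; have fr : orthonormal_frame_at g hor q (X p).
  by near: q; apply: frame_near; exact: frH.
have tY : tangent (pi q) (Y' (pi q)).
  by apply: section_value; near: q; apply: (near_comp sub_smooth
    (P := fun b => section_at tanB b Y')); exact: section_near.
have [h hh dh] := dmap_surj tY.
rewrite field_sumE -dh [in RHS](frame_expand (horizontal_linear g pi) fr hh);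
  congr (dmap _ _ _).
apply: eq_bigr => i _; rewrite /scale_field -dh dmap_hor//.
exact: frame_in fr.
Unshelve. all: by end_near. Qed.

Lemma basic_extend p x : hor p x -> exists Y Y', basic p Y Y' /\ Y p = x.
Proof.
move=> hx; have /tangentP[d [ad dp [a dE]]] := dmapT (hor_tan hx).
have sY' := coord_field_section a ad dp.
have [Y bY] := lift_exists sY'; exists Y, (coord_field d a); split=> //.
case: bY => sY _ rY; apply: (@dmap_inj p) => //; first exact: section_value sY.
by rewrite dE (nbhs_singleton rY).
Qed.

Lemma basic_near p Y Y' : basic p Y Y' -> \forall q \near p, basic q Y Y'.
Proof.
case=> sY sY' /near_open[ O [ oO Op HO]]; near=> q; split.
- by near: q; exact: section_near.
- by near: q; apply: (near_comp sub_smooth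
  (P := fun b => section_at tanB b Y')); exact: section_near.
- apply: (open_nearS oO) => //.
  by near: q; apply: open_nbhs_nbhs; split.
Unshelve. all: by end_near. Qed.

Lemma dmap_app p v f : smooth_at (pi p) f -> dmap pi p v f = v (f \o pi).
Proof. by move=> sf; rewrite /dmap asboolT. Qed.

Lemma lie_related p Y Z Y' Z' : section_at tan p Y -> section_at tan p Z ->
  section_at tanB (pi p) Y' -> section_at tanB (pi p) Z' ->
  related p Y Y' -> related p Z Z' ->
  dmap pi p (lie Y Z p) = lie Y' Z' (pi p).
Proof.
move=> sY sZ sY' sZ' rY rZ; apply/funext => f; rewrite /lie /dmap.
case: asboolP => // sf; have ss := sub_smooth.
rewrite asboolT; last exact: smooth_at_comp.
(* Each half of the bracket is natural. Near [p] is needed because [dmap] tests the smoothness of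
   [f] at every nearby image point. *)
have step V W V' W' : section_at tan p V -> related p V V' -> related p W W' ->
    section_at tanB (pi p) W' ->
    V p (app W (f \o pi)) = V' (pi p) (app W' f).
  move=> sV rV rW sW'; have sWf : smooth_at (pi p)
    (app W' f) by exact: field_smooth_at.
  rewrite -(nbhs_singleton rV) dmap_app//.
  apply: (tangent_ext (section_value sV)); near=> q.
  have sfq : smooth_at (pi q) f.
    near: q; apply: (near_comp ss (P := fun b => smooth_at b f)).
    by case: sf => W0 [ oW Wp sf]; apply: (open_nearS oW Wp) => b Wb; exists W0.
  rewrite /app -(dmap_app _ sfq); congr (_ f).
  by near: q; exact: rW.
by rewrite (step _ _ Y' Z') // (step _ _ Z' Y').
Unshelve. all: by end_near. Qed.

End Lift.

(** * Skew-symmetry of A and O'Neill's equation *)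

Section ONeillFormula.
Context {R : realType} {m n : nat} {M : manifold R m} {B : manifold R n}.
Variables (g : metric M) (gB : metric B) (pi : M -> B).
Hypothesis sub : riemannian_submersion g gB pi.
Variables (r l : nat) (U : M -> 'I_r -> field M) (X : M -> 'I_l -> field M).
Hypothesis frV : forall p, orthonormal_frame_at g (vertical pi) p (U p).
Hypothesis frH : forall p, orthonormal_frame_at g (horizontal g pi) p (X p).
Variables (nabla : connection M) (nablaB : connection B).
Hypothesis lc : levi_civita g (@tangent R m M) nabla.
Hypothesis lcB : levi_civita gB (@tangent R n B) nablaB.

Notation ver := (vertical pi).
Notation hor := (horizontal g pi).
Notation tan := (@tangent R m M).
Notation tanB := (@tangent R n B).
Notation basic := (basic g pi).
Let tl := @tangent_linear R m M.
Let tlB := @tangent_linear R n B.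

Lemma vprojB p u v : tangent p u -> tangent p v ->
  vproj g pi p (u - v) = vproj g pi p u - vproj g pi p v.
Proof.
move=> tu tv; have [vu hu] := projP frV tu; have [vv hv] := projP frV tv.
apply: vproj_uniq; first exact: (distB (vertical_linear pi)).
suff -> : u - v - (vproj g pi p u - vproj g pi p v) = hproj g pi p u - hproj g
  pi p v.
  exact: (distB (horizontal_linear g pi)).
rewrite /hproj !opprB -!addrA; congr (u + _).
by rewrite addrCA [RHS]addrCA; congr (_ + _); rewrite addrC.
Qed.

Lemma basic_hor p Y Y' : basic p Y Y' -> section_at hor p Y. Proof. by case.
  Qed.
Lemma basic_tan p Y Y' : basic p Y Y' -> section_at tan p Y.
Proof. by move=> /basic_hor; exact: hor_sec_tan. Qed.
Lemma basic_base p Y Y' : basic p Y Y' -> section_at tanB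
  (pi p) Y'. Proof. by case. Qed.
Lemma basic_related p Y Y' : basic p Y Y' -> related pi p Y Y'. Proof. by
  case. Qed.
Lemma basic_value p Y Y' : basic p Y Y' -> dmap pi p (Y p) = Y' (pi p).
Proof. by case=> _ _ /nbhs_singleton. Qed.

(** A vertical field is related to 0, so the bracket is related to the bracket of Y' with 0. *)
Lemma lie_ver p Y Y' V : basic p Y Y' -> section_at ver p V -> ver p
  (lie Y V p).
Proof.
move=> bY sV; have tY := basic_tan bY; have tV := ver_sec_tan sV.
split; first exact: (lie_in tl lc).
have rV : related pi p V 0.
  by apply: filterS (section_near sV) => q /section_value[].
rewrite (lie_related sub tY tV (basic_base bY) (section0 tlB _)
  (basic_related bY) rV).
apply/funext => f; rewrite /lie; case: ifP => // _.
by rewrite [X in X - _](tangent_cst 0 (section_value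
  (basic_base bY))) sub0r oppr0.
Qed.

(** The two derivatives differ by the bracket, which is vertical and so invisible to the horizontal
    [z]. *)
Lemma cov_basic_swap p Y Y' V z : basic p Y Y' -> section_at ver p V -> hor p
  z ->
  g p (cov nabla Y V p) z = g p (cov nabla V Y p) z.
Proof.
move=> bY sV hz; have tY := basic_tan bY; have tV := ver_sec_tan sV.
apply/eqP; rewrite -subr_eq0 -metricBl; try exact: (cov_tangent lc).
  by rewrite -(lc_torsion lc)// (metric_vh (lie_ver bY sV) hz).
exact: hor_tan hz.
Qed.

(** Differentiate g(Y, V), which vanishes near [p]. *)
Lemma cov_shift p u Y V : tangent p u -> section_at hor p Y -> section_at ver
  p V ->
  g p (nabla p u Y) (V p) = - g p (Y p) (nabla p u V).
Proof.
move=> tu sY sV; apply/eqP; rewrite -addr_eq0; apply/eqP.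
rewrite -(lc_metric lc tu (hor_sec_tan sY)
  (ver_sec_tan sV)) -[RHS](tangent_cst 0 tu).
apply: (tangent_ext tu); near=> q.
have vV : ver q (V q) by apply: section_value; near: q;
  exact: (section_near sV).
have hY : hor q (Y q) by apply: section_value; near: q;
  exact: (section_near sY).
exact: metric_hv vV hY.
Unshelve. all: by end_near. Qed.

(** Near [p] the function g(P, Y) is the pullback of gB(P', Y'). [P] is only required to be related
    to [P'], so that it may be a covariant derivative of basic fields. *)
Lemma related_metric p v P P' Y Y' : tangent p v -> section_at tan p P ->
  section_at tanB (pi p) P' -> related pi p P P' -> basic p Y Y' ->
  v (fun q => g q (P q) (Y q)) = dmap pi p v (fun b => gB b (P' b) (Y' b)).
Proof.
move=> tv sP sP' rP bY; rewrite dmap_app; last first.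
  by apply: metric_smooth_at => //; exact: basic_base bY.
apply: (tangent_ext tv); near=> q => /=.
have -> : P' (pi q) = dmap pi q (P q) by apply/esym; near: q; exact: rP.
have -> : Y' (pi q) = dmap pi q (Y q) by apply/esym; near: q;
  exact: basic_related bY.
rewrite (dmap_metric sub frV)//; apply: section_value; near: q;
  apply: section_near => //.
exact: basic_hor bY.
Unshelve. all: by end_near. Qed.

(** For a basic extension Y of x, g(Y, nabla_Y V) = g(Y, nabla_V Y) = V(g(Y,Y))/2, and g(Y,Y) is
    constant along fibers, being a pullback from the base. *)
Lemma cov_ver_diag p x V : hor p x -> section_at ver p V -> g p x
  (nabla p x V) = 0.
Proof.
move=> hx sV; have [Y [Y' [bY Yp]]] := basic_extend sub frV frH hx.
have tY := basic_tan bY; have tV := ver_sec_tan sV; have vV := section_value sV.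
have tc := cov_tangent lc tV tY.
have tYV := cov_tangent lc tY tV; have tYp := section_value tY.
rewrite -{}Yp in hx *; rewrite -[nabla p _ V]/(cov nabla Y V p).
rewrite (metricC g tYp tYV) (cov_basic_swap bY sV hx).
have := lc_metric lc (ver_tan vV) tY tY.
rewrite (related_metric (ver_tan vV) tY (basic_base bY) (basic_related bY) bY).
rewrite (dmap_ver vV) -[nabla p _ Y]/(cov nabla V Y p) (metricC g tYp tc).
by rewrite -[X in X = _ -> _]/(0 : R) => /esym/eqP;
  rewrite -mulr2n mulrn_eq0/= => /eqP.
Qed.

(** Polarization of [cov_ver_diag] at [x + y]. *)
Lemma cov_ver_skew p x y V : hor p x -> hor p y -> section_at ver p V ->
  g p x (nabla p y V) = - g p y (nabla p x V).
Proof.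
move=> hx hy sV; have tx := hor_tan hx; have ty := hor_tan hy.
have tV := ver_sec_tan sV.
have tn u : tangent p u -> tangent p (nabla p u V) by move=> tu;
  exact: (lc_in lc).
have := cov_ver_diag (distD (horizontal_linear g pi) hx hy) sV.
have tnx := tn _ tx; have tny := tn _ ty; have tnD := distD tl tnx tny.
rewrite (lcDl lc)// metricDl// !metricDr//.
by rewrite (cov_ver_diag hx sV) (cov_ver_diag hy sV) add0r addr0 => /eqP;
  rewrite addr_eq0 => /eqP.
Qed.

(** Moving the derivative onto a vertical extension of [v] leaves only the values of [Y] and [Z] at
    [p]; hence skew-symmetry for all horizontal sections, not just basic ones. *)
Lemma cov_hor_skew p Y Z v : section_at hor p Y -> section_at hor p Z -> ver p
  v ->
  g p (cov nabla Y Z p) v = - g p (cov nabla Z Y p) v.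
Proof.
move=> sY sZ vv; have [V sV <-] := dist_extend (vertical_linear pi) (frV p) vv.
have hY := section_value sY; have hZ := section_value sZ.
rewrite /cov (cov_shift (hor_tan hY) sZ sV) (cov_shift (hor_tan hZ) sY sV).
by rewrite (cov_ver_skew hZ hY sV).
Qed.

Lemma cov_hor_diag p Y : section_at hor p Y -> hor p (cov nabla Y Y p).
Proof.
move=> sY; have tY := hor_sec_tan sY; apply: (horP frV);
  first exact: (cov_tangent lc).
move=> k; have := cov_hor_skew sY sY (frame_in k (frV p)).
by move=> /eqP; rewrite -addr_eq0 -mulr2n mulrn_eq0/= => /eqP.
Qed.

Lemma A_skew p Y Z : section_at hor p Y -> section_at hor p Z ->
  vproj g pi p (cov nabla Z Y p) = - vproj g pi p (cov nabla Y Z p).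
Proof.
move=> sY sZ; have vl := vertical_linear pi.
have tYZ := cov_tangent lc (hor_sec_tan sY) (hor_sec_tan sZ).
have tZY := cov_tangent lc (hor_sec_tan sZ) (hor_sec_tan sY).
have vZY := vproj_in frV tZY; have vYZ := vproj_in frV tYZ.
apply/eqP; rewrite -addr_eq0; apply/eqP.
have vd : ver p (vproj g pi p (cov nabla Z Y p) + vproj g pi p
  (cov nabla Y Z p)).
  exact: (distD vl).
apply: (metric_eq0 (g := g) (ver_tan vd)).
rewrite {1}metricDl; try by [exact: ver_tan vZY|exact: ver_tan vYZ|exact:
  ver_tan vd].
by rewrite !(metric_vproj frV)// (cov_hor_skew sZ sY vd) addNr.
Qed.

Lemma basic_cov p Y Y' Z Z' : basic p Y Y' -> basic p Z Z' ->
  dmap pi p (cov nabla Y Z p) = cov nablaB Y' Z' (pi p).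
Proof.
move=> bY bZ; have tY := basic_tan bY; have tZ := basic_tan bZ.
have tY' := basic_base bY; have tZ' := basic_base bZ.
have tc := cov_tangent lc tY tZ; have tc' := lc_cov_in lcB tY' tZ'.
have tdc := dmapT sub tc.
apply/subr0_eq; set d := _ - _.
have td : tangent (pi p) d by exact: (distB tlB).
(* The difference is tested against itself: its horizontal lift extends to a basic [W], and the two
   Koszul expressions then match term by term. *)
have [h hh dh] := dmap_surj sub frV td.
have [W [W' [bW Wp]]] := basic_extend sub frV frH hh.
have tW := basic_tan bW; have tW' := basic_base bW.
apply: (metric_eq0 (g := gB) td); rewrite {1}/d metricBl//; apply/eqP;
  rewrite subr_eq0.
have dW : W' (pi p) = d by rewrite -(basic_value bW) Wp.
have two : (2 : R) != 0 by rewrite pnatr_eq0.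
rewrite -{1}dh (dmap_metric sub frV)// -Wp -dW -(inj_eq (mulfI two)).
rewrite (koszul tl lc tY tZ tW) (koszul tlB lcB tY' tZ' tW').
have tYp := section_value tY; have tZp := section_value tZ;
  have tWp := section_value tW.
rewrite (related_metric tYp tZ tZ' (basic_related bZ) bW) (basic_value bY).
rewrite (related_metric tZp tY tY' (basic_related bY) bW) (basic_value bZ).
rewrite (related_metric tWp tY tY' (basic_related bY) bZ) (basic_value bW).
have lieE C C' D D' F F' : basic p C C' -> basic p D D' -> basic p F F' ->
    g p (lie C D p) (F p) = gB (pi p) (lie C' D' (pi p)) (F' (pi p)).
  move=> bC bD bF; have tC := basic_tan bC; have tD := basic_tan bD.
  rewrite -(lie_related sub tC tD (basic_base bC) (basic_base bD)
    (basic_related bC) (basic_related bD)).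
  rewrite -(basic_value bF) (dmap_metric sub frV)//;
    first exact: (lie_in tl lc).
  exact: section_value (basic_hor bF).
by rewrite (lieE _ _ _ _ _ _ bY bZ bW) (lieE _ _ _ _ _ _ bY bW bZ)
  (lieE _ _ _ _ _ _ bZ bW bY).
Qed.

Lemma cov_related p Y Y' Z Z' : basic p Y Y' -> basic p Z Z' ->
  related pi p (cov nabla Y Z) (cov nablaB Y' Z').
Proof.
move=> bY bZ; apply: filterS2 (basic_near sub bY) (basic_near sub bZ) => q.
exact: basic_cov.
Qed.

Lemma basic_nabla p u Z Z' : hor p u -> basic p Z Z' ->
  dmap pi p (nabla p u Z) = nablaB (pi p) (dmap pi p u) Z'.
Proof.
move=> hu bZ; have [Y [Y' [bY <-]]] := basic_extend sub frV frH hu.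
by rewrite (basic_value bY); exact: basic_cov bY bZ.
Qed.

Lemma nabla_lie_hor p Y Y' Z Z' : basic p Y Y' -> basic p Z Z' ->
  g p (nabla p (hproj g pi p (lie Y Z p)) Z) (Y p) =
  gB (pi p) (nablaB (pi p) (lie Y' Z' (pi p)) Z') (Y' (pi p)).
Proof.
move=> bY bZ; have tY := basic_tan bY; have tZ := basic_tan bZ.
have tl' := lie_in tl lc tY tZ; have hl := hproj_in frV tl'.
have tn := lc_in lc (hor_tan hl) tZ.
rewrite -(dmap_metric sub frV tn (section_value (basic_hor bY)))
  (basic_value bY).
rewrite (basic_nabla hl bZ) (dmap_hproj frV tl').
by rewrite (lie_related sub tY tZ (basic_base bY) (basic_base bZ)
  (basic_related bY) (basic_related bZ)).
Qed.

(** By skew-symmetry the vertical part of [Y,Z] is 2a with a = A_Y Z. For a vertical V with value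
    2a, g(nabla_V Z, Y) = g(nabla_Z V, Y) = - g(V, A_Z Y) = g(2a, a). *)
Lemma nabla_lie_ver p Y Y' Z Z' : basic p Y Y' -> basic p Z Z' ->
  g p (nabla p (vproj g pi p (lie Y Z p)) Z) (Y p) =
  2 * sqnorm g p (vproj g pi p (cov nabla Y Z p)).
Proof.
move=> bY bZ; have tY := basic_tan bY; have tZ := basic_tan bZ.
have hY := basic_hor bY; have hZ := basic_hor bZ.
have tYZ := cov_tangent lc tY tZ; have tZY := cov_tangent lc tZ tY.
have vYZ := vproj_in frV tYZ; have tv := ver_tan vYZ.
rewrite (lc_torsion lc tY tZ) vprojB// (A_skew hY hZ) opprK.
set a := vproj g pi p _ in vYZ tv *.
have va : ver p (a + a) by exact: (distD (vertical_linear pi)).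
have [V sV Vp] := dist_extend (vertical_linear pi) (frV p) va.
rewrite -Vp -[nabla p _ Z]/(cov nabla V Z p).
rewrite -(cov_basic_swap bZ sV (section_value hY)).
have tV := ver_sec_tan sV; have tZV := cov_tangent lc tZ tV.
have tYp := section_value tY.
have := cov_shift (section_value tZ) hY sV;
  rewrite -[nabla p _ V]/(cov nabla Z V p).
rewrite (metricC g tYp tZV) => /eqP; rewrite -eqr_oppLR => /eqP <-.
rewrite -[nabla p _ Y]/(cov nabla Z Y p) -(metric_vproj frV tZY
  (section_value sV)).
rewrite (A_skew hY hZ) -/a metricNl ?Vp; try by [|exact: ver_tan va].
by rewrite metricDr// opprK /sqnorm mulr_natl.
Qed.

(** Differentiate g(nabla_Z Z, Y) along Y on both levels. No A-term appears, because nabla_Y Y is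
    horizontal. *)
Lemma nabla_nabla_YZZ p Y Y' Z Z' : basic p Y Y' -> basic p Z Z' ->
  g p (cov nabla Y (cov nabla Z Z) p) (Y p) =
  gB (pi p) (cov nablaB Y' (cov nablaB Z' Z') (pi p)) (Y' (pi p)).
Proof.
move=> bY bZ; have tY := basic_tan bY; have tZ := basic_tan bZ.
have tY' := basic_base bY; have tZ' := basic_base bZ.
have tYp := section_value tY; have tYp' := section_value tY'.
have sZZ := lc_cov_section lc tZ tZ; have sZZ' := lc_cov_section lcB tZ' tZ'.
have := related_metric tYp sZZ sZZ' (cov_related bZ bZ) bY.
rewrite (lc_metric lc tYp sZZ tY) (basic_value bY)
  (lc_metric lcB tYp' sZZ' tY').
have hYY := cov_hor_diag (basic_hor bY).
rewrite -[nabla p _ Y]/(cov nabla Y Y p) -(dmap_metric sub frV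
  (section_value sZZ) hYY).
by rewrite (basic_cov bZ bZ) (basic_cov bY bY) => /addIr.
Qed.

(** Differentiate g(nabla_Y Z, Y) along Z on both levels. The vertical parts contribute g(A_Y Z, A_Z
    Y) = - |A_Y Z|^2, which is not seen in the base. *)
Lemma nabla_nabla_ZYZ p Y Y' Z Z' : basic p Y Y' -> basic p Z Z' ->
  g p (cov nabla Z (cov nabla Y Z) p) (Y p) =
  gB (pi p) (cov nablaB Z' (cov nablaB Y' Z') (pi p)) (Y' (pi p)) +
  sqnorm g p (vproj g pi p (cov nabla Y Z p)).
Proof.
move=> bY bZ; have tY := basic_tan bY; have tZ := basic_tan bZ.
have tY' := basic_base bY; have tZ' := basic_base bZ.
have tZp := section_value tZ; have tZp' := section_value tZ'.
have sYZ := lc_cov_section lc tY tZ; have sYZ' := lc_cov_section lcB tY' tZ'.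
have := related_metric tZp sYZ sYZ' (cov_related bY bZ) bY.
rewrite (lc_metric lc tZp sYZ tY) (basic_value bZ)
  (lc_metric lcB tZp' sYZ' tY').
have tYZ := cov_tangent lc tY tZ; have tZY := cov_tangent lc tZ tY.
have vYZ := vproj_in frV tYZ.
rewrite -[nabla p _ Y]/(cov nabla Z Y p) (metric_split frV tYZ tZY).
rewrite (A_skew (basic_hor bY) (basic_hor bZ)) metricNr; try exact: ver_tan vYZ.
rewrite -(dmap_hor sub (hproj_in frV tYZ)
  (hproj_in frV tZY)) !(dmap_hproj frV)//.
rewrite (basic_cov bY bZ) (basic_cov bZ bY) /sqnorm.
rewrite -[nabla p _ (cov _ _ _)]/(cov nabla Z (cov nabla Y Z) p).
rewrite -[nablaB _ _ (cov _ _ _)]/(cov nablaB Z' (cov nablaB Y' Z') (pi p)).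
rewrite -[nablaB _ _ Y']/(cov nablaB Z' Y' (pi p)).
by set x := g p _ _; set y := g p _ _; set z := gB _ _ _; set w := gB _ _ _;
  lra.
Qed.

(** The 3 is 2 + 1: two from the vertical part of the bracket, one from the term nabla_Z nabla_Y
    Z. *)
Lemma oneill_formula p Y Y' Z Z' : basic p Y Y' -> basic p Z Z' ->
  g p (curv nabla Y Z Z p) (Y p) =
  gB (pi p) (curv nablaB Y' Z' Z' (pi p)) (Y' (pi p)) +
  3 * sqnorm g p (vproj g pi p (cov nabla Y Z p)).
Proof.
move=> bY bZ; have tY := basic_tan bY; have tZ := basic_tan bZ.
have tY' := basic_base bY; have tZ' := basic_base bZ.
have tl' := lie_in tl lc tY tZ; have tlB' := lie_in tlB lcB tY' tZ'.
have [vl hl] := projP frV tl'.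
have tYp := section_value tY; have tYp' := section_value tY'.
have c1 := cov_tangent lc tY (lc_cov_section lc tZ tZ).
have c2 := cov_tangent lc tZ (lc_cov_section lc tY tZ).
have c1' := lc_cov_in lcB tY' (lc_cov_section lcB tZ' tZ').
have c2' := lc_cov_in lcB tZ' (lc_cov_section lcB tY' tZ').
have n0 := lc_in lc tl' tZ; have n0' := lc_in lcB tlB' tZ'.
have nv := lc_in lc (ver_tan vl) tZ; have nh := lc_in lc (hor_tan hl) tZ.
rewrite -[curv nabla Y Z Z p]/(nabla p (lie Y Z p) Z - cov nabla Y
  (cov nabla Z Z) p
  + cov nabla Z (cov nabla Y Z) p).
rewrite -[curv nablaB Y' Z' Z' (pi p)]/(nablaB (pi p) (lie Y' Z' (pi p)) Z'
  - cov nablaB Y' (cov nablaB Z' Z') (pi p) + cov nablaB Z'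
    (cov nablaB Y' Z') (pi p)).
rewrite (metricDl g (distB tl n0 c1) c2 tYp) (metricBl g n0 c1 tYp).
rewrite (metricDl gB (distB tlB n0' c1') c2' tYp') (metricBl gB n0' c1' tYp').
rewrite (nabla_nabla_YZZ bY bZ) (nabla_nabla_ZYZ bY bZ).
rewrite {1}(proj_dec g pi p (lie Y Z p)) (lcDl lc (ver_tan vl) (hor_tan hl) tZ).
rewrite metricDl// (nabla_lie_ver bY bZ) (nabla_lie_hor bY bZ).
ring.
Qed.

End ONeillFormula.

(** * Gauss' equation and mixed curvatures *)

Section GaussAndMixed.
Context {R : realType} {m n : nat} {M : manifold R m} {B : manifold R n}.
Variables (g : metric M) (gB : metric B) (pi : M -> B).
Hypothesis sub : riemannian_submersion g gB pi.
Variables (r l : nat) (U : M -> 'I_r -> field M) (X : M -> 'I_l -> field M).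
Hypothesis frV : forall p, orthonormal_frame_at g (vertical pi) p (U p).
Hypothesis frH : forall p, orthonormal_frame_at g (horizontal g pi) p (X p).
Variables (nabla nablaV : connection M).
Hypothesis lc : levi_civita g (@tangent R m M) nabla.
Hypothesis lcV : levi_civita g (vertical pi) nablaV.

Notation ver := (vertical pi).
Notation hor := (horizontal g pi).
Notation tan := (@tangent R m M).
Let tl := @tangent_linear R m M.
Let vl := vertical_linear pi.

(** Tested against vertical fields, both connections satisfy Koszul's formula with the same
    right-hand side. *)
Lemma vproj_cov p V W : section_at ver p V -> section_at ver p W ->
  vproj g pi p (cov nabla V W p) = cov nablaV V W p.
Proof.
move=> sV sW; have tV := ver_sec_tan sV; have tW := ver_sec_tan sW.
have tc := cov_tangent lc tV tW; have vc := lc_cov_in lcV sV sW.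
have vd := distB vl (vproj_in frV tc) vc.
apply/subr0_eq/(metric_eq0 (g := g) (ver_tan vd)).
have [Z sZ Zp] := dist_extend vl (frV p) vd; rewrite -{2}Zp.
have vZ := section_value sZ; have tZp := ver_tan vZ.
rewrite metricBl//; try by [exact: ver_tan vc|exact: ver_tan (vproj_in frV tc)].
rewrite (metric_vproj frV tc vZ); apply/eqP; rewrite subr_eq0.
have two : (2 : R) != 0 by rewrite pnatr_eq0.
rewrite -(inj_eq (mulfI two)) (koszul tl lc tV tW (ver_sec_tan sZ)).
by rewrite (koszul vl lcV sV sW sZ).
Qed.

(** Symmetry of T. The ambient derivatives and their vertical parts yield the same bracket, so the
    horizontal parts have difference 0. *)
Lemma hproj_cov_sym p V W : section_at ver p V -> section_at ver p W ->
  hproj g pi p (cov nabla V W p) = hproj g pi p (cov nabla W V p).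
Proof.
move=> sV sW; have tV := ver_sec_tan sV; have tW := ver_sec_tan sW.
have tVW := cov_tangent lc tV tW; have tWV := cov_tangent lc tW tV.
have := lc_torsion lcV sV sW; rewrite (lc_torsion lc tV tW) -!vproj_cov//.
rewrite /hproj; set a := cov _ _ _ _; set b := cov _ _ _ _.
move=> ab; apply/eqP; rewrite -subr_eq0 opprB (addrC
  (vproj _ _ _ b)) addrACA ab.
by rewrite addrACA subrr addNr addr0.
Qed.

(* Only the horizontal parts of the two inner derivatives distinguish the
   ambient from the fiber connection, by metric compatibility of both. *)
Lemma nabla_nabla_ver p P V W Q : section_at ver p P -> section_at ver p V ->
  section_at ver p W -> section_at ver p Q ->
  g p (cov nabla P (cov nabla V W) p) (Q p) =
  g p (cov nablaV P (cov nablaV V W) p) (Q p)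
  - g p (hproj g pi p (cov nabla V W p)) (hproj g pi p (cov nabla P Q p)).
Proof.
move=> sP sV sW sQ; have tP := ver_sec_tan sP; have tV := ver_sec_tan sV.
have tW := ver_sec_tan sW; have tQ := ver_sec_tan sQ.
have vP := section_value sP; have tPp := section_value tP.
have sVW := lc_cov_section lc tV tW; have sVW' := lc_cov_section lcV sV sW.
have tVW := cov_tangent lc tV tW; have tPQ := cov_tangent lc tP tQ.
have : P p (fun q => g q (cov nabla V W q) (Q q)) = P p (fun q => g q
  (cov nablaV V W q) (Q q)).
  apply: (tangent_ext tPp); near=> q.
  have sVq : section_at ver q V by near: q; exact: (section_near sV).
  have sWq : section_at ver q W by near: q; exact: (section_near sW).
  have sQq : section_at ver q Q by near: q; exact: (section_near sQ).
  rewrite -vproj_cov// (metric_vproj frV)//; last exact: section_value sQq.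
  exact: (cov_tangent lc (ver_sec_tan sVq) (ver_sec_tan sWq)).
rewrite (lc_metric lc tPp sVW tQ) (lc_metric lcV vP sVW' sQ).
rewrite -[nabla p _ Q]/(cov nabla P Q p) -[nablaV p _ Q]/(cov nablaV P Q p).
rewrite -(vproj_cov sV sW) -(vproj_cov sP sQ) (metric_split frV tVW tPQ).
rewrite -[nabla p _ _]/(cov nabla P (cov nabla V W) p).
rewrite -[nablaV p _ _]/(cov nablaV P (cov nablaV V W) p).
by set x := g p _ _; set y := g p _ _; set z := g p _ _; set w := g p _ _; lra.
Unshelve. all: by end_near. Qed.

Lemma gauss_formula p V W : section_at ver p V -> section_at ver p W ->
  g p (curv nablaV V W W p) (V p) = g p (curv nabla V W W p) (V p)
  - g p (hproj g pi p (cov nabla W W p)) (hproj g pi p (cov nabla V V p))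
  + sqnorm g p (hproj g pi p (cov nabla V W p)).
Proof.
move=> sV sW; have tV := ver_sec_tan sV; have tW := ver_sec_tan sW.
have vL := lie_in vl lcV sV sW; have tVp := section_value tV.
have c1 := cov_tangent lc tV (lc_cov_section lc tW tW).
have c2 := cov_tangent lc tW (lc_cov_section lc tV tW).
have c1' := ver_tan (lc_cov_in lcV sV (lc_cov_section lcV sW sW)).
have c2' := ver_tan (lc_cov_in lcV sW (lc_cov_section lcV sV sW)).
have n0 := lc_in lc (ver_tan vL) tW; have n0' := ver_tan (lc_in lcV vL sW).
rewrite -[curv nabla V W W p]/(nabla p (lie V W p) W - cov nabla V
  (cov nabla W W) p
  + cov nabla W (cov nabla V W) p).
rewrite -[curv nablaV V W W p]/(nablaV p (lie V W p) W
  - cov nablaV V (cov nablaV W W) p + cov nablaV W (cov nablaV V W) p).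
rewrite (metricDl g (distB tl n0 c1) c2 tVp) (metricBl g n0 c1 tVp).
rewrite (metricDl g (distB tl n0' c1') c2' tVp) (metricBl g n0' c1' tVp).
rewrite (nabla_nabla_ver sV sW sW sV) (nabla_nabla_ver sW sV sW sV).
rewrite (hproj_cov_sym sW sV) /sqnorm.
(* Only the value of the bracket matters as a direction; extending it to a vertical section makes
   [vproj_cov] applicable. *)
have -> : g p (nabla p (lie V W p) W) (V p) = g p (nablaV p (lie V W p) W)
  (V p).
  have [L sL Lp] := dist_extend vl (frV p) vL.
  rewrite -Lp -[nablaV p _ W]/(cov nablaV L W p) -vproj_cov//.
  rewrite (metric_vproj frV)//; last exact: section_value sV.
  exact: (cov_tangent lc (ver_sec_tan sL) tW).
ring.
Qed.

(** Torsion-freeness replaces the bracket by two covariant derivatives, so every remaining term can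
    later be expanded in the frames. *)
Lemma mixed_formula p Y V : section_at hor p Y -> section_at ver p V ->
  g p (curv nabla Y V V p) (Y p) =
  g p (nabla p (cov nabla Y V p) V) (Y p) - g p (nabla p (cov nabla V Y p) V)
    (Y p)
  - g p (cov nabla Y (hpart g pi (cov nabla V V)) p) (Y p)
  - g p (cov nabla Y V p) (cov nabla V Y p).
Proof.
move=> sY sV; have tY := hor_sec_tan sY; have tV := ver_sec_tan sV.
have tYp := section_value tY; have tVp := section_value tV.
have tYV := cov_tangent lc tY tV; have tVY := cov_tangent lc tV tY.
have sVV := lc_cov_section lc tV tV; have sYV := lc_cov_section lc tY tV.
have shVV := hpart_section frV frH sVV; have hYY := cov_hor_diag sub frV frH
  lc sY.
have tVV := section_value sVV.
have c1 := cov_tangent lc tY sVV; have c2 := cov_tangent lc tV sYV.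
have n1 := lc_in lc tYV tV; have n2 := lc_in lc tVY tV.
have -> : curv nabla Y V V p = nabla p (cov nabla Y V p - cov nabla V Y p) V
  - cov nabla Y (cov nabla V V) p + cov nabla V (cov nabla Y V) p.
  by rewrite -(lc_torsion lc tY tV).
have -> : nabla p (cov nabla Y V p - cov nabla V Y p) V =
    nabla p (cov nabla Y V p) V - nabla p (cov nabla V Y p) V.
  by rewrite (lcDl lc tYV (distN tl tVY) tV) -scaleN1r (lcZl tl lc)// scaleN1r.
have n12 := distB tl n1 n2.
rewrite (metricDl g (distB tl n12 c1) c2 tYp) (metricBl g n12 c1 tYp)
  (metricBl g n1 n2 tYp).
(* Pairing with Y sees only the horizontal part of nabla_V V, and the correction term involves
   nabla_Y Y, which is horizontal. *)
have -> : g p (cov nabla Y (cov nabla V V) p) (Y p) =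
    g p (cov nabla Y (hpart g pi (cov nabla V V)) p) (Y p).
  have := lc_metric lc tYp sVV tY.
  have -> : Y p (fun q => g q (cov nabla V V q) (Y q)) =
      Y p (fun q => g q (hpart g pi (cov nabla V V) q) (Y q)).
    apply: (tangent_ext tYp); near=> q.
    have hYq : hor q (Y q) by apply: section_value; near: q;
      exact: (section_near sY).
    rewrite /hpart (metric_hproj frV)//.
    by apply: section_value; near: q; exact: (section_near sVV).
  rewrite (lc_metric lc tYp (hor_sec_tan shVV) tY) /hpart
    (metric_hproj frV tVV hYY).
  by move=> /addIr.
(* By [cov_ver_diag] the function g(nabla_Y V, Y) vanishes near [p]; differentiate it along V. *)
suff -> : g p (cov nabla V (cov nabla Y V) p) (Y p) = - g p (cov nabla Y V p)
  (cov nabla V Y p).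
  ring.
apply/eqP; rewrite -addr_eq0 -(lc_metric lc tVp sYV tY); apply/eqP.
rewrite -[RHS](tangent_cst 0 tVp); apply: (tangent_ext tVp); near=> q.
have sYq : section_at hor q Y by near: q; exact: (section_near sY).
have sVq : section_at ver q V by near: q; exact: (section_near sV).
have hYq := section_value sYq.
rewrite metricC; last 2 first.
- exact: (cov_tangent lc (hor_sec_tan sYq) (ver_sec_tan sVq)).
- exact: hor_tan hYq.
exact: (cov_ver_diag sub frV frH lc hYq sVq).
Unshelve. all: by end_near. Qed.

End GaussAndMixed.

(** * Sums over orthonormal frames *)

Section FrameSums.
Context {R : realType} {m n : nat} {M : manifold R m} {B : manifold R n}.
Variables (g : metric M) (gB : metric B) (pi : M -> B).
Hypothesis sub : riemannian_submersion g gB pi.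
Variables (r l : nat) (U : M -> 'I_r -> field M) (X : M -> 'I_l -> field M).
Hypothesis frV : forall p, orthonormal_frame_at g (vertical pi) p (U p).
Hypothesis frH : forall p, orthonormal_frame_at g (horizontal g pi) p (X p).
Variables (nabla nablaV : connection M).
Hypothesis lc : levi_civita g (@tangent R m M) nabla.
Hypothesis lcV : levi_civita g (vertical pi) nablaV.

Notation ver := (vertical pi).
Notation hor := (horizontal g pi).
Notation tan := (@tangent R m M).
Let tl := @tangent_linear R m M.
Let vl := vertical_linear pi.
Let hl := horizontal_linear g pi.

Lemma metric_frames p v w : tangent p v -> tangent p w ->
  g p v w = \sum_j g p v (X p j p) * g p w (X p j p) +
            \sum_k g p v (U p k p) * g p w (U p k p).
Proof.
move=> tv tw; have [vv hv] := projP frV tv.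
have tvv := ver_tan vv; have thv := hor_tan hv.
rewrite {1}(proj_dec g pi p v) metricDl//.
rewrite (metric_frame hl (frH p) hv tw) (metric_frame vl (frV p) vv tw) addrC.
congr (_ + _); apply: eq_bigr => j _.
  by rewrite (metric_hproj frV tv (frame_in j (frH p))).
by rewrite (metric_vproj frV tv (frame_in j (frV p))).
Qed.

Lemma nabla_frames p v Y w : tangent p v -> section_at tan p Y -> tangent p w ->
  g p (nabla p v Y) w = \sum_j g p v (X p j p) * g p (cov nabla (X p j) Y p) w +
            \sum_k g p v (U p k p) * g p (cov nabla (U p k) Y p) w.
Proof.
move=> tv sY tw; have [vv hv] := projP frV tv.
have tX j := hor_tan (frame_in j (frH p));
  have tU k := ver_tan (frame_in k (frV p)).
have tnX j := lc_in lc (tX j) sY; have tnU k := lc_in lc (tU k) sY.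
have ex (D : distribution M) k0 (F : 'I_k0 -> field M) u : linear_distribution
  D ->
    orthonormal_frame_at g D p F -> D p u -> (forall j, tangent p (F j p)) ->
    (forall j, g p u (F j p) = g p v (F j p)) ->
    g p (nabla p u Y) w = \sum_j g p v (F j p) * g p (cov nabla (F j) Y p) w.
  move=> lD fr Du tF uv; rewrite {1}(frame_expand lD fr Du).
  rewrite (lc_suml tl lc)//; last by move=> j; exact: (distZ tl).
  have tn j : tangent p (nabla p (F j p) Y) by exact: (lc_in lc).
  rewrite metric_suml//; last by move=> j; rewrite (lcZl tl lc)//;
    exact: (distZ tl).
  by apply: eq_bigr => j _; rewrite (lcZl tl lc)// metricZl// uv.
rewrite {1}(proj_dec g pi p v) (lcDl lc (ver_tan vv)
  (hor_tan hv) sY) metricDl//; last 2 first.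
- exact: (lc_in lc (ver_tan vv)).
- exact: (lc_in lc (hor_tan hv)).
rewrite addrC; congr (_ + _).
  apply: (ex _ _ _ _ hl (frH p) hv tX) => j.
  exact: (metric_hproj frV tv (frame_in j (frH p))).
apply: (ex _ _ _ _ vl (frV p) vv tU) => j.
exact: (metric_vproj frV tv (frame_in j (frV p))).
Qed.

Lemma normTHE p : normTH g pi nabla (U p) p =
  \sum_j \sum_k \sum_i g p (cov nabla (U p j) (U p k) p) (X p i p) ^+ 2.
Proof.
apply: eq_bigr => j _; apply: eq_bigr => k _.
have sU j := frame_section j (frV p); have tU j := ver_sec_tan (sU j).
have tc := cov_tangent lc (tU j) (tU k).
rewrite (oneillT_ver lc (sU j) (sU k)) (sqnorm_frame hl (frH p)
  (hproj_in frV tc)).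
apply: eq_bigr => i _; rewrite (metric_hproj frV tc) //.
exact: frame_in (frH p).
Qed.

(** The components of T_U X are, up to sign, those of T_U U by [cov_shift]; squaring removes the
    sign. *)
Lemma normTVE p : normTV g pi nabla (U p) (X p) p =
  \sum_i \sum_k \sum_j g p (cov nabla (U p k) (U p j) p) (X p i p) ^+ 2.
Proof.
apply: eq_bigr => i _; apply: eq_bigr => k _.
have sU j := frame_section j (frV p); have tU j := ver_sec_tan (sU j).
have sX := frame_section i (frH p); have tX := hor_sec_tan sX.
have tc := cov_tangent lc (tU k) tX.
rewrite (oneillT_hor lc (sU k) sX) (sqnorm_frame vl (frV p) (vproj_in frV tc)).
apply: eq_bigr => j _; rewrite (metric_vproj frV tc) ;
  last exact: frame_in (frV p).
rewrite (cov_shift lc (section_value (tU k)) sX (sU j)) sqrrN.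
rewrite -[nabla p _ _]/(cov nabla (U p k) (U p j) p) metricC//.
  exact: section_value tX.
exact: (cov_tangent lc).
Qed.

Lemma normTV_TH p : normTV g pi nabla (U p) (X p) p = normTH g pi nabla (U p) p.
Proof.
rewrite normTVE normTHE exchange_big; apply: eq_bigr => k _.
by rewrite exchange_big.
Qed.

Lemma normAHE p : normAH g pi nabla (U p) (X p) p =
  \sum_i \sum_k \sum_j g p (cov nabla (X p i) (U p k) p) (X p j p) ^+ 2.
Proof.
apply: eq_bigr => i _; apply: eq_bigr => k _.
have sU := frame_section k (frV p); have sX := frame_section i (frH p).
have tc := cov_tangent lc (hor_sec_tan sX) (ver_sec_tan sU).
rewrite (oneillA_ver lc sX sU) (sqnorm_frame hl (frH p) (hproj_in frV tc)).
apply: eq_bigr => j _; rewrite (metric_hproj frV tc) //.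
exact: frame_in (frH p).
Qed.

(** Equality at [p] alone would not do: [deltaN] differentiates the mean field. *)
Lemma mean_field_near p :
  \forall q \near p, (\sum_k hpart g pi (cov nabla (U p k) (U p k))) q =
    mean_field g pi nabla (U p) q.
Proof.
near=> q; have fr : orthonormal_frame_at g ver q (U p).
  by near: q; apply: frame_near; exact: frV.
rewrite /mean_field !field_sumE; apply: eq_bigr => k _.
by rewrite (oneillT_ver lc)//; exact: frame_section fr.
Unshelve. all: by end_near. Qed.

Lemma mean_fieldE p : mean_field g pi nabla (U p) p =
  \sum_k hproj g pi p (cov nabla (U p k) (U p k) p).
Proof. by rewrite -(nbhs_singleton (mean_field_near p)) field_sumE. Qed.

Lemma deltaNE p : deltaN g pi nabla (U p) (X p) p = \sum_i \sum_k
  g p (cov nabla (X p i) (hpart g pi (cov nabla (U p k) (U p k))) p) (X p i p).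
Proof.
apply: eq_bigr => i _.
have tX := hor_tan (frame_in i (frH p)).
have sH k : section_at tan p (hpart g pi (cov nabla (U p k) (U p k))).
  apply/hor_sec_tan/(hpart_section frV frH)/(lc_cov_section lc);
  exact: ver_sec_tan (frame_section k (frV p)).
rewrite /cov -(lc_local tl lc tX (section_sum tl _ sH) (mean_field_near p)).
rewrite (lc_sumr tl lc)// metric_suml// => k.
exact: (lc_in lc).
Qed.

Lemma mixed_sum p :
  \sum_i \sum_k g p (curv nabla (X p i) (U p k) (U p k) p) (X p i p) =
  - deltaN g pi nabla (U p) (X p) p - normAH g pi nabla (U p) (X p) p
  + normTV g pi nabla (U p) (X p) p.
Proof.
have sU k := frame_section k (frV p); have sX i := frame_section i (frH p).
have tU k := ver_sec_tan (sU k); have tX i := hor_sec_tan (sX i).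
have tUp k := section_value (tU k); have tXp i := section_value (tX i).
have tXU i k := cov_tangent lc (tX i) (tU k);
  have tUX i k := cov_tangent lc (tU k) (tX i).
have tUU k j := cov_tangent lc (tU k) (tU j).
(* [a] holds the components of A, [t] those of T, and [om] the coefficients of the vertical frame
   along horizontal directions; [om] and [th] are not tensorial. *)
pose a i k j := g p (cov nabla (X p i) (U p k) p) (X p j p).
pose om i k j := g p (cov nabla (X p i) (U p k) p) (U p j p).
pose t k j i := g p (cov nabla (U p k) (U p j) p) (X p i p).
pose th k i j := g p (cov nabla (U p k) (X p i) p) (X p j p).
pose d i k := g p (cov nabla (X p i) (hpart g pi (cov nabla (U p k)
  (U p k))) p) (X p i p).
have askew i k j : a i k j = - a j k i.
  rewrite /a (metricC g (tXU i k) (tXp j)) (metricC g (tXU j k) (tXp i)).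
  exact: (cov_ver_skew sub frV frH lc (section_value (sX j)) (section_value
    (sX i)) (sU k)).
have tsym k j i : t k j i = t j k i.
  rewrite /t -(metric_hproj frV (tUU k j) (section_value (sX i))).
  rewrite (hproj_cov_sym frV lc lcV (sU k) (sU j)).
  exact: (metric_hproj frV (tUU j k) (section_value (sX i))).
have omskew i k j : om i k j = - om i j k.
  apply/eqP; rewrite -addr_eq0 {2}/om (metricC g (tXU i j) (tUp k)); apply/eqP.
  rewrite -(lc_metric lc (tXp i) (tU k) (tU j)).
  rewrite -[RHS](tangent_cst (k == j)%:R (tXp i)); apply: (tangent_ext (tXp i)).
  near=> q; have fr : orthonormal_frame_at g ver q (U p).
    by near: q; apply: frame_near; exact: frV.
  exact: (frame_orth k j fr).
have UXU k i j : g p (cov nabla (U p k) (X p i) p) (U p j p) = - t k j i.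
  by rewrite /cov (cov_shift lc (tUp k) (sX i) (sU j)) (metricC g (tXp i)
    (tUU k j)).
(* The [th] terms of the second and the last term of [mixed_formula] cancel for each pair; the [om]
   terms add up to a double contribution. *)
have pair i k : g p (curv nabla (X p i) (U p k) (U p k) p) (X p i p) =
    - (\sum_j a i k j ^+ 2) + (\sum_j t k j i ^+ 2) + 2 *
      (\sum_j om i k j * t k j i) - d i k.
  rewrite (mixed_formula sub frV frH lc (sX i) (sU k)) -/(d i k).
  rewrite (nabla_frames (tXU i k) (tU k) (tXp i)) (nabla_frames (tUX i k)
    (tU k) (tXp i)).
  rewrite (metric_frames (tXU i k) (tUX i k)).
  have -> : \sum_j g p (cov nabla (X p i) (U p k) p) (X p j p) *
      g p (cov nabla (X p j) (U p k) p) (X p i p) = - \sum_j a i k j ^+ 2.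
    by rewrite -sumrN; apply: eq_bigr => j _;
      rewrite -/(a i k j) -/(a j k i) (askew j) mulrN expr2.
  have -> : \sum_j g p (cov nabla (U p k) (X p i) p) (X p j p) *
      g p (cov nabla (X p j) (U p k) p) (X p i p) = - \sum_j a i k j * th k i j.
    rewrite -sumrN; apply: eq_bigr => j _;
      rewrite -/(th k i j) -/(a j k i) (askew j).
    by rewrite mulrN mulrC.
  have -> : \sum_j g p (cov nabla (X p i) (U p k) p) (U p j p) *
      g p (cov nabla (U p j) (U p k) p) (X p i p) = \sum_j om i k j * t k j i.
    by apply: eq_bigr => j _; rewrite -/(om i k j) -/(t j k i) tsym.
  have -> : \sum_j g p (cov nabla (U p k) (X p i) p) (U p j p) *
      g p (cov nabla (U p j) (U p k) p) (X p i p) = - \sum_j t k j i ^+ 2.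
    by rewrite -sumrN; apply: eq_bigr => j _;
      rewrite UXU -/(t j k i) (tsym j) mulNr expr2.
  have -> : \sum_j g p (cov nabla (X p i) (U p k) p) (U p j p) *
      g p (cov nabla (U p k) (X p i) p) (U p j p) = - \sum_j om i k j * t k j i.
    by rewrite -sumrN; apply: eq_bigr => j _; rewrite UXU mulrN.
  rewrite -/(a i k _); ring.
(* [om] is skew and [t] symmetric in the vertical indices, so the contraction is its own
   opposite. *)
have om0 i : \sum_k \sum_j om i k j * t k j i = 0.
  set s := LHS; have : s = - s.
    rewrite {1}/s exchange_big -sumrN; apply: eq_bigr => k _; rewrite -sumrN.
    by apply: eq_bigr => j _; rewrite omskew tsym mulNr.
  by move=> /eqP; rewrite -addr_eq0 -mulr2n mulrn_eq0/= => /eqP.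
under eq_bigr do under eq_bigr do rewrite pair.
rewrite deltaNE normAHE normTVE -/d.
under eq_bigr do rewrite !big_split /= -mulr_sumr om0 mulr0 addr0 !sumrN.
by rewrite !big_split/= !sumrN -/d addrC addrA.
Unshelve. all: by end_near. Qed.

(** The double sum of g(T_{U_i} U_i, T_{U_j} U_j) is |N|^2 by bilinearity. *)
Lemma gauss_sum p : tau_hat g (U p) nablaV p =
  \sum_i \sum_j g p (curv nabla (U p j) (U p i) (U p i) p) (U p j p)
  - sqnorm g p (mean_field g pi nabla (U p) p) + normTH g pi nabla (U p) p.
Proof.
have sU k := frame_section k (frV p); have tU k := ver_sec_tan (sU k).
have hUU k j := hproj_in frV (cov_tangent lc (tU k) (tU j)).
have thUU k j := hor_tan (hUU k j).
have -> : sqnorm g p (mean_field g pi nabla (U p) p) = \sum_i \sum_j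
    g p (hproj g pi p (cov nabla (U p i) (U p i) p)) (hproj g pi p (cov nabla
      (U p j) (U p j) p)).
  rewrite /sqnorm mean_fieldE metric_suml//; last exact: (dist_sum tl).
  by apply: eq_bigr => i _; rewrite metric_sumr.
have -> : normTH g pi nabla (U p) p = \sum_i \sum_j
    sqnorm g p (hproj g pi p (cov nabla (U p j) (U p i) p)).
  rewrite exchange_big; apply: eq_bigr => j _; apply: eq_bigr => i _.
  by rewrite (oneillT_ver lc (sU j) (sU i)).
rewrite -sumrN -!big_split/=; apply: eq_bigr => i _.
rewrite -sumrN -!big_split/=; apply: eq_bigr => j _.
by rewrite (gauss_formula frV lc lcV (sU j) (sU i)).
Qed.

Lemma mean_curvatureE p : r%:R ^+ 2 * sqnorm g p (mean_curvature g pi nabla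
  (U p) p) =
  sqnorm g p (mean_field g pi nabla (U p) p).
Proof.
have tN : tangent p (mean_field g pi nabla (U p) p).
  rewrite mean_fieldE; apply: (dist_sum tl) => k; apply/hor_tan/(hproj_in frV).
  by apply: (cov_tangent lc); exact: ver_sec_tan (frame_section k (frV p)).
rewrite /sqnorm -[mean_curvature _ _ _ _ p]/(r%:R^-1 *: mean_field g pi nabla
  (U p) p).
rewrite metricZl ?metricZr//; try exact: (distZ tl).
(* For r = 0 the inverse of r does not cancel, but the mean field is then an empty sum. *)
have [r0|r0] := eqVneq (r%:R : R) 0; last by rewrite expr2; field.
rewrite r0 expr0n mul0r [in RHS](_ : mean_field _ _ _ _ p = 0).
  by rewrite metric0l//; exact: (dist0 tl).
rewrite mean_fieldE; move/eqP: r0; rewrite pnatr_eq0 => /eqP r0.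
by apply: big1 => -[k kr] _; exfalso; rewrite r0 in kr.
Qed.

End FrameSums.

Section BaseCurvature.
Context {R : realType} {m n : nat} {M : manifold R m} {B : manifold R n}.
Variables (g : metric M) (gB : metric B) (pi : M -> B).
Hypothesis sub : riemannian_submersion g gB pi.
Variables (r l : nat) (U : M -> 'I_r -> field M) (X : M -> 'I_l -> field M).
Hypothesis frV : forall p, orthonormal_frame_at g (vertical pi) p (U p).
Hypothesis frH : forall p, orthonormal_frame_at g (horizontal g pi) p (X p).
Variables (nabla nablaV : connection M) (nablaB : connection B).
Hypothesis lc : levi_civita g (@tangent R m M) nabla.
Hypothesis lcV : levi_civita g (vertical pi) nablaV.
Hypothesis lcB : levi_civita gB (@tangent R n B) nablaB.
Variables (RB : curvature_op B) (Rs : curvature_op M).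
Hypothesis RBE : curvature_tensor (@tangent R n B) nablaB RB.
Hypothesis RsE : horizontal_curvature g pi RB Rs.

Notation ver := (vertical pi).
Notation hor := (horizontal g pi).
Notation tan := (@tangent R m M).
Let vl := vertical_linear pi.

(** Tensoriality of A: by [cov_shift], each vertical component is - g(Z, nabla_Y V), where only the
    values of Y and Z at [p] enter. *)
Lemma A_value p Y Z Y' Z' : section_at hor p Y -> section_at hor p Z ->
  section_at hor p Y' -> section_at hor p Z' -> Y p = Y' p -> Z p = Z' p ->
  vproj g pi p (cov nabla Y Z p) = vproj g pi p (cov nabla Y' Z' p).
Proof.
move=> sY sZ sY' sZ' YY' ZZ'.
have tc := cov_tangent lc (hor_sec_tan sY) (hor_sec_tan sZ).
have tc' := cov_tangent lc (hor_sec_tan sY') (hor_sec_tan sZ').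
have vd := distB vl (vproj_in frV tc) (vproj_in frV tc').
apply/subr0_eq/(metric_eq0 (g := g) (ver_tan vd)).
have [V sV Vp] := dist_extend vl (frV p) vd; rewrite -{2}Vp.
have vV := section_value sV.
rewrite (metricBl g (ver_tan (vproj_in frV tc)) (ver_tan (vproj_in frV tc'))
  (ver_tan vV)).
rewrite (metric_vproj frV tc vV) (metric_vproj frV tc' vV).
rewrite (cov_shift lc (hor_tan (section_value sY)) sZ sV).
rewrite (cov_shift lc (hor_tan (section_value sY')) sZ' sV).
by rewrite YY' ZZ' subrr.
Qed.

(** [P] and [Q] are basic extensions of the given values, as O'Neill's equation requires. Leaving
    them existential is harmless: the space form equation reads only their values at [p]. *)
Lemma horizontal_curvatureE p Y Z : section_at hor p Y -> section_at hor p Z ->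
  exists P Q, [/\ section_at tan p P, section_at tan p Q, P p = Y p, Q p = Z p &
    g p (Rs p (Y p) (Z p) (Z p)) (Y p) =
    g p (curv nabla P Q Q p) (P p) - 3 * sqnorm g p (oneillA g pi nabla Y Z p)].
Proof.
move=> sY sZ; have hY := section_value sY; have hZ := section_value sZ.
have [P [P' [bP Pp]]] := basic_extend sub frV frH hY.
have [Q [Q' [bQ Qp]]] := basic_extend sub frV frH hZ.
exists P, Q; split=> //; [exact: basic_tan bP|exact: basic_tan bQ|].
have [hR dR] := RsE hY hZ hZ.
rewrite (oneill_formula sub frV frH lc lcB bP bQ) (oneillA_hor lc sY sZ).
rewrite (A_value (basic_hor bP) (basic_hor bQ) sY sZ Pp Qp) addrK.
rewrite -(dmap_hor sub hR hY) dR -Pp -Qp (basic_value bP) (basic_value bQ).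
by rewrite (RBE (basic_base bP) (basic_base bQ) (basic_base bQ)).
Qed.

Lemma normTH_ge0 p : 0 <= normTH g pi nabla (U p) p.
Proof.
rewrite (normTHE frV frH lc); apply: sumr_ge0 => j _; apply: sumr_ge0 => k _.
by apply: sumr_ge0 => i _; exact: sqr_ge0.
Qed.

Lemma normTH_eq0 p : normTH g pi nabla (U p) p = 0 <->
  forall V W, section_at ver p V -> section_at ver p W -> ver p
    (cov nabla V W p).
Proof.
have sU k := frame_section k (frV p); have tU k := ver_sec_tan (sU k).
have hX i := frame_in i (frH p); have tX i := hor_tan (hX i).
rewrite (normTHE frV frH lc); split=> [T0 V W sV sW|Tv].
  have t0 k j i : g p (cov nabla (U p k) (U p j) p) (X p i p) = 0.
    have s0 (I : finType) (F : I -> R) :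
      (forall i, 0 <= F i) -> \sum_i F i = 0 ->
        forall i, F i = 0.
      by move=> F0 sF i0; apply: (psumr_eq0P _ sF).
    apply/eqP; rewrite -sqrf_eq0; apply/eqP.
    apply: (s0 _ (fun i => g p (cov nabla (U p k) (U p j) p) (X p i p) ^+ 2)).
      by move=> i'; exact: sqr_ge0.
    apply: (s0 _ (fun j => \sum_i g p (cov nabla (U p k) (U p j) p)
      (X p i p) ^+ 2)).
      by move=> j'; apply: sumr_ge0 => i' _; exact: sqr_ge0.
    apply: (s0 _ (fun k => \sum_j \sum_i g p (cov nabla (U p k) (U p j) p)
      (X p i p) ^+ 2)) => //.
    by move=> k'; apply: sumr_ge0 => j' _; apply: sumr_ge0 => i' _;
      exact: sqr_ge0.
  (* Only the direction can be expanded in the frame. Symmetry of T exchanges the two arguments, so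
     the expansion is used once for [V] and once for [W]. *)
  have step P Q i : section_at ver p P -> section_at ver p Q ->
      (forall k, g p (cov nabla (U p k) Q p) (X p i p) = 0) ->
      g p (cov nabla P Q p) (X p i p) = 0.
    move=> sP sQ Q0; have vP := section_value sP.
    rewrite {1}/cov (nabla_frames frV frH lc (ver_tan vP) (ver_sec_tan sQ)
      (tX i)).
    rewrite big1 => [|j _]; last by rewrite (metric_vh vP (hX j)) mul0r.
    by rewrite add0r big1// => k _; rewrite Q0 mulr0.
  have tW := ver_sec_tan sW; have tV := ver_sec_tan sV.
  apply: (verP frV frH) => [|i]; first exact: (cov_tangent lc).
  apply: (step V W) => // k; have tc := cov_tangent lc (tU k) tW.
  rewrite -(metric_hproj frV tc (hX i)) (hproj_cov_sym frV lc lcV (sU k) sW).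
  rewrite (metric_hproj frV (cov_tangent lc tW (tU k)) (hX i)).
  by apply: (step W (U p k)) => // j; exact: t0.
apply: big1 => j _; apply: big1 => k _; apply: big1 => i _.
by rewrite (metric_vh (Tv _ _ (sU j) (sU k)) (hX i)) expr0n.
Qed.

End BaseCurvature.

(** * Quaternionic space forms *)

Section SpaceForm.
Context {R : realType} {m : nat} {M : manifold R m} (g : metric M).
Variables (nabla : connection M) (E : M -> set (functional M -> functional M)).
Variable c : R.
Hypothesis sf : quaternionic_space_form g E nabla c.
Notation tan := (@tangent R m M).

Section Basis.
Variables (p : M) (J : 'Z_3 -> @endo_field R m M).
Hypothesis admJ : admissible_basis_at g E p J.

Lemma J_in a v : tangent p v -> tangent p (J a p v).
Proof. by have [W [ oW Wp [H _ _ _ _]]] := admJ; have [HJ _ _] := H a;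
  exact: HJ. Qed.

(** Write v as -J(J v) and use that J is an isometry. *)
Lemma J_skew a u v : tangent p u -> tangent p v -> g p (J a p u) v = - g p
  (J a p v) u.
Proof.
move=> tu tv; have [W [ oW Wp [_ JJ _ gJ _]]] := admJ.
have tJv := J_in a tv; have tJu := J_in a tu.
rewrite -[v in LHS]opprK -(JJ a p v Wp tv) metricNr//; last exact: J_in.
by rewrite gJ// metricC.
Qed.

Lemma J_diag a v : tangent p v -> g p (J a p v) v = 0.
Proof.
move=> tv; have /eqP := J_skew a tv tv.
by rewrite -addr_eq0 -mulr2n mulrn_eq0/= => /eqP.
Qed.

(** In each quaternionic summand g(JZ, Z) = 0, and skewness turns the middle term into g(JZ, Y)^2;
    with the last term, 2 g(JZ, Y)^2, this gives the 3. *)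
Lemma space_form_value Y Z : section_at tan p Y -> section_at tan p Z ->
  g p (curv nabla Y Z Z p) (Y p) = c / 4 *
    (g p (Y p) (Y p) * g p (Z p) (Z p) - g p (Z p) (Y p) ^+ 2 +
     3 * \sum_a g p (J a p (Z p)) (Y p) ^+ 2).
Proof.
move=> sY sZ; have [W [ oW Wp aJ]] := admJ.
have tY := section_value sY; have tZ := section_value sZ.
have tl := @tangent_linear R m M.
case: sf => _ /(_ W J oW aJ p Y Z Z Wp sY sZ sZ) ->.
have tJY a := J_in a tY; have tJZ a := J_in a tZ.
have tt a : tangent p (g p (J a p (Z p)) (Z p) *: J a p (Y p)
                - g p (J a p (Y p)) (Z p) *: J a p (Z p)
                + (2 * g p (J a p (Z p)) (Y p)) *: J a p (Z p)).
  by apply: (distD tl); [apply: (distB tl)|]; exact: (distZ tl).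
rewrite metricZl//; last first.
  apply: (distD tl); first by apply: (distB tl); exact: (distZ tl).
  exact: (dist_sum tl).
congr (_ * _); rewrite metricDl//; last 2 first.
- by apply: (distB tl); exact: (distZ tl).
- exact: (dist_sum tl).
rewrite metricBl ?metricZl//; try exact: (distZ tl).
rewrite metric_suml// (metricC g tY tZ) mulr_sumr; congr (_ + _); first by ring.
apply: eq_bigr => a _; rewrite metricDl ?metricBl ?metricZl//;
  try exact: (distZ tl).
  rewrite (J_diag a tZ) (J_skew a tY tZ); ring.
by apply: (distB tl); exact: (distZ tl).
Qed.

End Basis.
End SpaceForm.

(** The constant curvature part summed over a frame; the square mirrors the term g(Z,Y)^2 of
    [space_form_value]. *)
Lemma sum_offdiag (R : realType) (k : nat) :
  \sum_(i < k) \sum_(j < k) (1 - (i == j)%:R ^+ 2) = k%:R * (k%:R - 1) :> R.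
Proof.
under eq_bigr => i _.
  rewrite sumrB sumr_const card_ord (bigD1 i)//= eqxx expr1n big1; last first.
    by move=> j ji; rewrite eq_sym (negbTE ji) expr0n.
  rewrite addr0; over.
by rewrite sumr_const card_ord mulr_natl.
Qed.

Theorem theorem3p10 (R : realType) (m n : nat)
    (M : manifold R (4 * m)) (gM : metric M) (nabla : connection M)
    (E : M -> set (functional M -> functional M)) (c : R)
    (B : manifold R n) (gB : metric B) (nablaB : connection B)
    (RB : curvature_op B)
    (pi : M -> B) (nablaV : connection M) (Rs : curvature_op M)
    (r l : nat)
    (U : M -> 'I_r -> field M) (X : M -> 'I_l -> field M)
    (J : M -> 'Z_3 -> endo_field) :
  levi_civita gM (@tangent R (4 * m) M) nabla ->
  quaternionic_space_form gM E nabla c ->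
  riemannian_submersion gM gB pi ->
  anti_invariant gM E pi ->
  levi_civita gB (@tangent R n B) nablaB ->
  curvature_tensor (@tangent R n B) nablaB RB ->
  horizontal_curvature gM pi RB Rs ->
  levi_civita gM (vertical pi) nablaV ->
  (forall p, orthonormal_frame_at gM (vertical pi) p (U p)) ->
  (forall p, orthonormal_frame_at gM (horizontal gM pi) p (X p)) ->
  (forall p, admissible_basis_at gM E p (J p)) ->
  let tau p := tau_hat gM (U p) nablaV p + tau_star gM (X p) Rs p in
  let common p :=
    c / 4 * ((l%:R + r%:R) * (l%:R + r%:R - 1) +
      \sum_(a : 'Z_3) \sum_(i < l)
        (6 * normBJ gM pi (U p) (X p) (J p a) i p +
         3 * normCJ gM pi (X p) (J p a) i p))
    - r%:R ^+ 2 * sqnorm gM p (mean_curvature gM pi nabla (U p) p) in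
  let lower p := common p
    + 2 * deltaN gM pi nabla (U p) (X p) p
    - 2 * normTV gM pi nabla (U p) (X p) p
    + 2 * normAH gM pi nabla (U p) (X p) p
    - 3 * normAV gM pi nabla (X p) p in
  let upper p := common p
    + normTH gM pi nabla (U p) p
    + 2 * deltaN gM pi nabla (U p) (X p) p
    + 2 * normAH gM pi nabla (U p) (X p) p
    - 3 * normAV gM pi nabla (X p) p in
  [/\ forall p, tau p >= lower p,
      forall p, tau p <= upper p,
      (forall p, tau p = lower p) <->
        (forall p, totally_geodesic_fiber pi nabla (pi p)) &
      (forall p, tau p = upper p) <->
        (forall p, totally_geodesic_fiber pi nabla (pi p))].
Proof.
move=> lc sf sub anti lcB RBE RsE lcV frV frH admJ tau common lower upper.
have tl := @tangent_linear R (4 * m) M; have vl := vertical_linear pi.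
have hl := horizontal_linear gM pi.
have sU p k := frame_section k (frV p); have sX p i := frame_section i (frH p).
have tU p k := ver_sec_tan (sU p k); have tX p i := hor_sec_tan (sX p i).
have vU p k := frame_in k (frV p); have hX p i := frame_in i (frH p).
have tUp p k := ver_tan (vU p k); have tXp p i := hor_tan (hX p i).
have oU p j k := frame_orth j k (frV p); have oX p i j := frame_orth i j
  (frH p).
have tJ p a v (tv : tangent p v) := J_in (admJ p) a tv.
(* Anti-invariance enters here: it removes every quaternionic term from the vertical sum [EV]. *)
have hJU p a k : horizontal gM pi p (J p a p (U p k p)).
  by have [W [oW Wp aJ]] := admJ p; exact: anti oW aJ _ _ _ Wp (vU p k).
pose SB p : R := \sum_(a : 'Z_3) \sum_(i < l) normBJ gM pi (U p) (X p)
  (J p a) i p.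
pose SC p : R := \sum_(a : 'Z_3) \sum_(i < l) normCJ gM pi (X p) (J p a) i p.
have EV p : \sum_i \sum_j gM p (curv nabla (U p j) (U p i) (U p i) p)
  (U p j p) =
    c / 4 * (r%:R * (r%:R - 1)).
  rewrite -sum_offdiag mulr_sumr; apply: eq_bigr => i _; rewrite mulr_sumr.
  apply: eq_bigr => j _; rewrite (space_form_value sf
    (admJ p))// !oU !eqxx mulr1.
  rewrite big1 ?mulr0 ?addr0// => a _.
  by rewrite (metric_hv (vU p j) (hJU p a i)) expr0n.
(* Between horizontal vectors g(J X_i, X_j) is a component of C_J X_i, so the quaternionic terms sum
   to 3 |C|^2. *)
have EH p : \sum_i \sum_j gM p (Rs p (X p i p) (X p j p) (X p j p)) (X p i p) =
    c / 4 * (l%:R * (l%:R - 1) + 3 * SC p) - 3 * normAV gM pi nabla (X p) p.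
  have -> : SC p = \sum_(i < l) \sum_(j < l) \sum_(a : 'Z_3)
      gM p (J p a p (X p j p)) (X p i p) ^+ 2.
    rewrite /SC exchange_big; under [RHS]eq_bigr do rewrite exchange_big.
    rewrite [RHS]exchange_big; under [RHS]eq_bigr do rewrite exchange_big.
    rewrite exchange_big; apply: eq_bigr => a _; rewrite [RHS]exchange_big.
    apply: eq_bigr => i _; apply: eq_bigr => j _.
    rewrite (metric_hproj frV (tJ _ _ _ (tXp p i)) (hX p j)).
    by rewrite (J_skew (admJ p) a (tXp p i) (tXp p j)) sqrrN.
  rewrite -sum_offdiag mulr_sumr -big_split mulr_sumr mulr_sumr -sumrB.
  apply: eq_bigr => i _; rewrite !mulr_sumr -big_split mulr_sumr -sumrB/=.
  apply: eq_bigr => j _.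
  have [P [Q [sP sQ Pp Qp ->]]] :=
    horizontal_curvatureE sub frV frH lc lcB RBE RsE (sX p i) (sX p j).
  rewrite (space_form_value sf (admJ p) sP sQ) Pp Qp !oX !eqxx mulr1
    (eq_sym j i).
  by rewrite mulr_sumr.
(* The mixed curvatures in two ways: between X_i and U_k the quaternionic terms are components of
   B_J X_i, while [mixed_sum] gives the right-hand side. *)
have EM p : c / 4 * (l%:R * r%:R + 3 * SB p) = - deltaN gM pi nabla (U p)
  (X p) p
    - normAH gM pi nabla (U p) (X p) p + normTV gM pi nabla (U p) (X p) p.
  rewrite -(mixed_sum sub frV frH lc lcV).
  have -> : l%:R * r%:R = \sum_(i < l) \sum_(k < r) (1 : R).
    by rewrite !sumr_const !card_ord mulr_natl.
  have -> : SB p = \sum_(i < l) \sum_(k < r) \sum_(a : 'Z_3)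
      gM p (J p a p (U p k p)) (X p i p) ^+ 2.
    rewrite /SB exchange_big; apply: eq_bigr => i _.
    rewrite [RHS]exchange_big; apply: eq_bigr => a _; apply: eq_bigr => k _.
    rewrite (metric_vproj frV (tJ _ _ _ (tXp p i)) (vU p k)).
    by rewrite (J_skew (admJ p) a (tXp p i) (tUp p k)) sqrrN.
  rewrite mulr_sumr -big_split mulr_sumr; apply: eq_bigr => i _.
  rewrite !mulr_sumr -big_split mulr_sumr; apply: eq_bigr => k _ /=.
  rewrite (space_form_value sf (admJ p))// oU oX !eqxx mulr1.
  by rewrite (metric_vh (vU p k) (hX p i)) expr0n subr0.
have commonE p : common p = c / 4 * ((l%:R + r%:R) * (l%:R + r%:R - 1)
    + 6 * SB p + 3 * SC p) - sqnorm gM p (mean_field gM pi nabla (U p) p).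
  rewrite /common (mean_curvatureE frV lc); congr (c / 4 * _ - _).
  rewrite -[RHS]addrA; congr (_ + _); rewrite /SB /SC !mulr_sumr -big_split.
  by apply: eq_bigr => a _; rewrite !mulr_sumr -big_split.
have tauE p : tau p = c / 4 * (r%:R * (r%:R - 1))
    - sqnorm gM p (mean_field gM pi nabla (U p) p) + normTH gM pi nabla (U p) p
    + (c / 4 * (l%:R * (l%:R - 1) + 3 * SC p) - 3 * normAV gM pi nabla (X p) p).
  by rewrite /tau /tau_star EH (gauss_sum frV lc lcV) EV.
have TVH p := normTV_TH frV frH lc p.
(* Subtracting twice [EM] accounts for everything but |T^H|^2. In [upE], [TVH] makes the surplus
   -2|T^V|^2 a multiple of the same quantity. *)
have lowE p : tau p = lower p + normTH gM pi nabla (U p) p.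
  have := EM p; rewrite tauE /lower commonE; move: (SB p) (SC p) => sB sC; lra.
have upE p : tau p = upper p - 2 * normTH gM pi nabla (U p) p.
  have := EM p; rewrite tauE /upper commonE TVH; move: (SB p) (SC p) => sB sC;
    lra.
have TH0 p := normTH_ge0 frV frH lc p.
(* Both equality cases amount to T = 0 on all of M. A condition on the fiber through [p] concerns
   all its points [q], which matches the quantifier over M. *)
have geo : (forall p, normTH gM pi nabla (U p) p = 0) <->
    (forall p, totally_geodesic_fiber pi nabla (pi p)).
  split=> [T0 p q V W _ sV sW|tg p].
    exact: (normTH_eq0 frV frH lc lcV q).1.
  by apply/(normTH_eq0 frV frH lc lcV) => V W; exact: tg.
split=> [p|p||].
- by rewrite lowE lerDl.
- by rewrite upE lerBlDr lerDl mulr_ge0.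
- rewrite -geo; split=> H p; last by rewrite lowE H addr0.
  by have := lowE p; rewrite -H; lra.
- rewrite -geo; split=> H p; last by rewrite upE H mulr0 subr0.
  by have := upE p; rewrite -H; lra.
Qed.
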